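(* Let $F$ be a field of characteristic $\ell=2$, let $V$ be an $F$-vector space of dimension $m=2n\geq 2$, and let $f:V\times V\to F$ be a non-degenerate alternating bilinear form. Then there is a basis of $V$ such that, identifying endomorphisms of $V$ with their matrices (in $n\times n$ blocks) relative to this basis, the following hold. (1) If $4\mid m$ then the $L(f)$-module $\mathfrak{gl}(V)$ has $m+6$ composition factors. A composition series can be obtained by inserting $m-1$ arbitrary subspaces (forming a strictly increasing chain) between $L(f)^{(1)}$ and $L(f)$ in the series $$0\subset \mathfrak{s}\subset L(f)^{(2)}\subset L(f)^{(1)}\subset L(f)\subset U\subset \mathfrak{sl}(V)\subset \mathfrak{gl}(V),$$ where $U=L(f)\oplus\langle x\rangle$, $x\in\mathfrak{sl}(V)$, $[x,L(f)]\subseteq L(f)$, and $$x=\begin{pmatrix} I_n & 0\\ 0& 0\end{pmatrix}.$$ All composition factors are trivial, except for $L(f)^{(2)}/\mathfrak{s}\cong \mathfrak{sl}(V)/U$ (isomorphic as $L(f)$-modules), which is of dimension $\binom{m}{2}-2$. Moreover, $L(f)^{(2)}/\mathfrak{s}$ is a simple Lie algebra if and only if $m>4$. (2) If $m\neq 2$ and $4\nmid m$ then the $L(f)$-module $\mathfrak{gl}(V)$ has $m+4$ composition factors. A composition series can be obtained by inserting $m-1$ arbitrary subspaces (forming a strictly increasing chain) between $L(f)^{(1)}$ and $L(f)$ in the series $$0\subset L(f)^{(2)}\subset L(f)^{(1)}\subset L(f)\subset \mathfrak{sl}(V)\subset \mathfrak{gl}(V).$$ All composition factors are trivial, except for $L(f)^{(2)}\cong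 \mathfrak{sl}(V)/L(f)$ (isomorphic as $L(f)$-modules). Moreover, $L(f)^{(2)}$ is a simple Lie algebra of dimension $\binom{m}{2}-1$. (3) $L(f)$ is isomorphic to the symmetric square $S^2(V)$ as $L(f)$-modules, and consists of all matrices $$(\ast)\qquad \begin{pmatrix} A & B\\ C& A'\end{pmatrix},\quad A,B,C\in\mathfrak{gl}(n),\ \text{where } B,C \text{ are symmetric.}$$ (4) $L(f)^{(1)}$ is isomorphic to the exterior square $\Lambda^2(V)$ as $L(f)$-modules, and consists of all matrices $(\ast)$ such that $B,C$ are alternating. (5) $L(f)^{(2)}$ is isomorphic to the kernel of the contraction $L(f)$-epimorphism $\Lambda^2(V)\to F$ given by $v\wedge w\mapsto f(v,w)$, and consists of all matrices $(\ast)$ such that $B,C$ are alternating and $\mathrm{tr}(A)=0$. (6) $L(f)/L(f)^{(2)}$ is isomorphic, as a Lie algebra, to $\mathfrak{h}(n)$, the Heisenberg algebra of dimension $2n+1$.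
   Context: $L(f)=\{x\in\mathfrak{gl}(V)\mid f(xv,w)=-f(v,xw)\text{ for all }v,w\in V\}$, a Lie subalgebra of $\mathfrak{gl}(V)$ (with $[x,y]=xy-yx$). $\mathfrak{gl}(V)$ is an $L(f)$-module via $x\cdot y=[x,y]$. $\mathfrak{s}$ is the space of scalar operators in $\mathfrak{gl}(V)$, and $\mathfrak{sl}(V)$ the space of traceless operators. For a Lie algebra $L$: $L^{(1)}=[L,L]$ and $L^{(2)}=[L^{(1)},L^{(1)}]$. A Lie algebra is simple if its dimension is $>1$ and its only ideals are $0$ and itself. A composition factor is trivial if it is one-dimensional with zero action. $A'$ is the transpose of $A$; a square matrix $A$ is alternating if $A_{ij}=-A_{ji}$ and $A_{ii}=0$ for all $i,j$. $V\otimes V$ is an $L(f)$-module via $x\cdot(v\otimes w)=xv\otimes w+v\otimes xw$; $S^2(V)$ and $\Lambda^2(V)$ denote its submodules: $S^2(V)$ is spanned by all $v\otimes v$ and $v\otimes w+w\otimes v$, and $\Lambda^2(V)$ is spanned by all $v\wedge w=v\otimes w-w\otimes v$ (so $\Lambda^2(V)\subseteq S^2(V)$ when the characteristic is $2$). $F$ is also viewed as the trivial one-dimensional $L(f)$-module. The Heisenberg algebra $\mathfrak{h}(n)$ has underlying space $V\oplus F$ with $[u+\beta,v+\gamma]=f(u,v)$ for $u,v\in V$, $\beta,\gamma\in F$. *)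

(* Defs.v *)
From mathcomp Require Import all_boot all_order all_algebra.
From HB Require Import structures.

Set Implicit Arguments.
Unset Strict Implicit.
Unset Printing Implicit Defensive.

Import GRing.Theory.
Local Open Scope ring_scope.

Lemma linear_lfunE (F : fieldType) (V W : vectType F) (g : V -> W) :
  linear g -> linfun g =1 g.
Proof.
move=> g_lin.
pose h : {linear V -> W} := HB.pack g
  (GRing.isSemilinear.Build F V W _ _ (GRing.semilinear_linear g_lin)).
exact: (lfunE h).
Qed.

Section Bilinear.
Variables (F : fieldType) (V W : vectType F).

Definition bilinear2 (b : V -> V -> W) : Prop :=
  (forall v, linear (b v)) /\ (forall w, linear (b^~ w)).

Variable b : V -> V -> W.
Hypothesis b_bil : bilinear2 b.

Lemma span_bilinear2 (U U' : {vspace V}) (Z : {vspace W}) :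
  (forall u v, u \in U -> v \in U' -> b u v \in Z) <->
  (<<[seq b u v | u <- vbasis U, v <- vbasis U']>> <= Z)%VS.
Proof.
have [linr linl] := b_bil; split=> [sub | sub u v uU vU'].
  apply/span_subvP=> z /allpairsP[[u v] /= [uU vU' ->]].
  by apply: sub; apply: vbasis_mem.
rewrite (coord_vbasis uU) -(linear_lfunE (linl v)) linear_sum.
apply: rpred_sum => i _; rewrite linearZ rpredZ //= linear_lfunE //.
rewrite (coord_vbasis vU') -(linear_lfunE (linr _)) linear_sum.
apply: rpred_sum => j _; rewrite linearZ rpredZ //= linear_lfunE //.
apply: (subvP sub); apply/memv_span/allpairs_f; apply: mem_nth;
  by rewrite size_tuple.
Qed.

End Bilinear.

(* V / W, realised on the complement W^C so that it is again a vectType; the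
   projection quo_pi is along W (which vsproj (W^C) need not be). *)
Notation quov W := (subvs_of (W^C)%VS).

Section Quotient.
Variables (F : fieldType) (V : vectType F).
Implicit Types (W : {vspace V}) (v : V).

Definition quo_pi W v : quov W := vsproj (W^C)%VS (daddv_pi (W^C)%VS W v).
Definition quo_repr W (y : quov W) : V := vsval y.

Let capCW W : (W^C :&: W)%VS = 0%VS. Proof. by rewrite capvC capv_compl. Qed.

Lemma quo_pi_linear W : linear (@quo_pi W).
Proof. by move=> a u v; rewrite /quo_pi !linearP. Qed.
HB.instance Definition _ W := GRing.isSemilinear.Build F V (quov W) _
  (@quo_pi W) (GRing.semilinear_linear (@quo_pi_linear W)).

Lemma quo_reprK W : cancel (@quo_repr W) (@quo_pi W).
Proof.
move=> y; rewrite /quo_pi daddv_pi_id ?vsvalK //; exact: subvsP.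
Qed.

Lemma quo_pi_eq0 W v : (quo_pi W v == 0) = (v \in W).
Proof.
have dv : daddv_pi (W^C) W v + daddv_pi W (W^C) v = v.
  by apply: daddv_pi_add => //; rewrite addvC addv_complf memvf.
have -> : (quo_pi W v == 0) = (daddv_pi (W^C)%VS W v == 0).
  rewrite /quo_pi -(inj_eq (@subvs_inj _ _ (W^C)%VS)) vsprojK //.
  exact: memv_pi.
apply/eqP/idP => [d0 | Wv].
  by rewrite -dv d0 add0r memv_pi.
rewrite -[X in daddv_pi _ _ X](@daddv_pi_id _ _ W (W^C)%VS) ?capv_compl //.
apply/eqP; rewrite -memv0 -(capCW W) memv_cap memv_pi /=.
rewrite -[X in X \in W](addrK (daddv_pi W (W^C)%VS (daddv_pi W (W^C)%VS v))).
set w := daddv_pi W (W^C)%VS v.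
have -> : daddv_pi (W^C)%VS W w + daddv_pi W (W^C)%VS w = w.
  by apply: daddv_pi_add => //; rewrite addvC addv_complf memvf.
by rewrite rpredB ?memv_pi.
Qed.

End Quotient.

Section Subquotient.
Variables (F : fieldType) (M : vectType F).
Implicit Types (U W : {vspace M}).

(* W, for W <= U, as a subspace of the vector space U *)
Definition restrv U W : {vspace subvs_of U} :=
  (linfun (vsval : subvs_of U -> M) @^-1: W)%VS.

Lemma mem_restrv U W (u : subvs_of U) : (u \in restrv U W) = (vsval u \in W).
Proof. by rewrite -memv_preim lfunE. Qed.

End Subquotient.

(* U / W for W <= U *)
Notation subquov W U := (quov (restrv U W)).

Section Modules.
Variables (F : fieldType) (A : Type).

Section Action.
Variables (M : vectType F) (act : A -> M -> M).
Implicit Types (U W : {vspace M}) (s : seq {vspace M}).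

Definition submodule U : Prop := forall a u, u \in U -> act a u \in U.

(* Meaningful for submodules U and W only: see sub_actE and quo_act_pi. *)
Definition sub_act U (a : A) (u : subvs_of U) : subvs_of U :=
  vsproj U (act a (vsval u)).
Definition quo_act W (a : A) (y : quov W) : quov W :=
  quo_pi W (act a (quo_repr y)).

Definition irreducible_mod : Prop :=
  {:M}%VS != 0%VS /\ forall U, submodule U -> U = 0%VS \/ U = {:M}%VS.

Definition trivial_factor : Prop :=
  \dim {:M} = 1%N /\ forall a (y : M), act a y = 0.

End Action.

Arguments sub_act [M] act U a u.
Arguments quo_act [M] act W a y.

(* the action on U / W, for submodules W <= U *)
Definition factor_act (M : vectType F) (act : A -> M -> M) (W U : {vspace M}) :
    A -> subquov W U -> subquov W U :=
  quo_act (sub_act act U) (restrv U W).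
Arguments factor_act [M] act W U a y.

Definition mod_iso (M N : vectType F) (actM : A -> M -> M) (actN : A -> N -> N)
  : Prop :=
  exists phi : 'Hom(M, N),
    bijective phi /\ forall a y, phi (actM a y) = actN a (phi y).

(* The consecutive pairs (W, U) of a series; each stands for the factor U/W. *)
Definition factors (M : vectType F) (s : seq {vspace M}) := zip s (behead s).

Definition composition_series (M : vectType F) (act : A -> M -> M)
    (s : seq {vspace M}) : Prop :=
  [/\ head {:M}%VS s = 0%VS, last 0%VS s = {:M}%VS,
      forall U, U \in s -> submodule act U
    & forall WU, WU \in factors s ->
        (WU.1 <= WU.2)%VS /\ irreducible_mod (factor_act act WU.1 WU.2)].

Definition has_composition_factors (M : vectType F) (act : A -> M -> M)
    (k : nat) : Prop :=
  (exists s, composition_series act s /\ size (factors s) = k) /\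
  (forall s, composition_series act s -> size (factors s) = k).

Lemma sub_actE (M : vectType F) (act : A -> M -> M) (U : {vspace M}) a u :
  submodule act U -> vsval (sub_act act U a u) = act a (vsval u).
Proof. by move=> sU; rewrite vsprojK // sU ?subvsP. Qed.

Lemma quo_act_pi (M : vectType F) (act : A -> M -> M) (W : {vspace M}) a v :
  linear (act a) -> submodule act W ->
  quo_act act W a (quo_pi W v) = quo_pi W (act a v).
Proof.
move=> lin_a sW; apply/eqP; rewrite -subr_eq0 -linearB quo_pi_eq0.
have -> : act a (quo_repr (quo_pi W v)) - act a v
        = act a (quo_repr (quo_pi W v) - v).
  by rewrite addrC -scaleN1r -lin_a scaleN1r addrC.
by apply: sW; rewrite -quo_pi_eq0 linearB /= quo_reprK subrr.
Qed.

End Modules.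

Arguments sub_act [F A M] act U a u.
Arguments quo_act [F A M] act W a y.
Arguments factor_act [F A M] act W U a y.

Definition proper_subv (F : fieldType) (M : vectType F) (U W : {vspace M}) :=
  (U <= W)%VS && (U != W).

(* A < t_1 < ... < t_k < B *)
Definition strict_chain (F : fieldType) (M : vectType F) (A B : {vspace M})
    (t : seq {vspace M}) (k : nat) : bool :=
  (size t == k) && path (@proper_subv F M) A (rcons t B).

Section Lie.
Variable F : fieldType.

Section Bracket.
Variables (L : vectType F) (br : L -> L -> L).
Implicit Types (U W Z I : {vspace L}).

Definition lie_algebra : Prop :=
  [/\ bilinear2 br, forall x, br x x = 0
    & forall x y z, br x (br y z) + br y (br z x) + br z (br x y) = 0].

Definition lie_ideal I : Prop := forall x y, y \in I -> br x y \in I.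

Definition lie_simple : Prop :=
  [/\ lie_algebra, (1 < \dim {:L})%N
    & forall I, lie_ideal I -> I = 0%VS \/ I = {:L}%VS].

(* [U, W]; same construction as prodv in falgebra *)
Definition brv U W : {vspace L} :=
  <<[seq br x y | x <- vbasis U, y <- vbasis W]>>%VS.

Lemma brv_sub U W Z :
  bilinear2 br ->
  (forall x y, x \in U -> y \in W -> br x y \in Z) <-> (brv U W <= Z)%VS.
Proof. by move=> br_bil; apply: span_bilinear2. Qed.

Definition derv U : {vspace L} := brv U U.

Lemma derv_stable U a :
  lie_algebra -> (forall u, u \in U -> br a u \in U) ->
  forall u, u \in derv U -> br a u \in derv U.
Proof.
move=> [br_bil alt jac] sU u; have [linr linl] := br_bil.
rewrite -(linear_lfunE (linr a)) memv_preim; apply/subvP/brv_sub => //.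
have brC x y : br x y = - br y x.
  apply/eqP; rewrite -addr_eq0; have := alt (x + y).
  rewrite -(linear_lfunE (linr _)) linearD /= !linear_lfunE //.
  rewrite -(linear_lfunE (linl x)) -(linear_lfunE (linl y)) !linearD /=.
  by rewrite !linear_lfunE // !alt add0r addr0 addrC => ->.
have brN x y : br x (- y) = - br x y.
  by rewrite -!(linear_lfunE (linr x)) linearN.
have mem x y : x \in U -> y \in U -> br x y \in derv U.
  by apply: (brv_sub U U (derv U) br_bil).2; apply: subvv.
move=> x y xU yU; rewrite -memv_preim linear_lfunE //.
have -> : br a (br x y) = br x (br a y) + br (br a x) y.
  apply/eqP; rewrite -subr_eq0 -(jac a x y) opprD addrA.
  by rewrite (brC y a) brN (brC y (br a x)).
by rewrite rpredD ?mem ?sU.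
Qed.

Definition sub_br U (x y : subvs_of U) : subvs_of U :=
  vsproj U (br (vsval x) (vsval y)).
Definition quo_br I (x y : quov I) : quov I :=
  quo_pi I (br (quo_repr x) (quo_repr y)).

Lemma quo_br_pi I x y :
  lie_algebra -> lie_ideal I ->
  quo_br (quo_pi I x) (quo_pi I y) = quo_pi I (br x y).
Proof.
move=> [[linr linl] alt _] idI; rewrite /quo_br.
set x' := quo_repr _; set y' := quo_repr _.
have Ix : x' - x \in I by rewrite -quo_pi_eq0 linearB /= quo_reprK subrr.
have Iy : y' - y \in I by rewrite -quo_pi_eq0 linearB /= quo_reprK subrr.
have brB u v w : br u (v - w) = br u v - br u w.
  by rewrite addrC -scaleN1r linr scaleN1r addrC.
have brC u v : br u v = - br v u.
  have brDr a b c : br a (b + c) = br a b + br a c.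
    by rewrite -[b]scale1r linr !scale1r.
  have brDl a b c : br (a + b) c = br a c + br b c.
    by rewrite -[a]scale1r linl !scale1r.
  apply/eqP; rewrite -addr_eq0; have := alt (u + v).
  by rewrite brDl !brDr !alt add0r addr0 => ->.
apply/eqP; rewrite -subr_eq0 -linearB quo_pi_eq0.
have -> : br x' y' - br x y = br x' (y' - y) - br y (x' - x).
  by rewrite (brC x y) opprK !brB (brC x' y) opprK opprB addrACA subrr addr0.
by rewrite rpredB ?idI.
Qed.

End Bracket.

Arguments sub_br [L] br U x y.
Arguments quo_br [L] br I x y.

Definition factor_br (L : vectType F) (br : L -> L -> L) (I U : {vspace L}) :
    subquov I U -> subquov I U -> subquov I U :=
  quo_br (sub_br br U) (restrv U I).

Definition lie_iso (L K : vectType F) (brL : L -> L -> L) (brK : K -> K -> K)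
  : Prop :=
  exists phi : 'Hom(L, K),
    bijective phi /\ forall x y, phi (brL x y) = brK (phi x) (phi y).

End Lie.

Arguments sub_br [F L] br U x y.
Arguments quo_br [F L] br I x y.
Arguments factor_br [F L] br I U x y.

Section GL.
Variables (F : fieldType) (V : vectType F).
Implicit Types x y z : 'End(V).

Definition gl_br x y : 'End(V) := (x \o y)%VF - (y \o x)%VF.

Lemma gl_lie : lie_algebra gl_br.
Proof.
have linl z : linear (gl_br^~ z).
  move=> a x y; rewrite /gl_br comp_lfunDl comp_lfunDr -comp_lfunZl -comp_lfunZr.
  by rewrite opprD addrACA scalerBr.
have linr z : linear (gl_br z).
  move=> a x y; rewrite /gl_br comp_lfunDl comp_lfunDr -comp_lfunZl -comp_lfunZr.
  by rewrite opprD addrACA scalerBr.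
split=> [|x|x y z]; first by split.
  by rewrite /gl_br subrr.
have compBr (u v w : 'End(V)) : (u \o (v - w))%VF = (u \o v)%VF - (u \o w)%VF.
  by rewrite comp_lfunDr comp_lfunNr.
have compBl (u v w : 'End(V)) : ((v - w) \o u)%VF = (v \o u)%VF - (w \o u)%VF.
  by rewrite comp_lfunDl comp_lfunNl.
rewrite /gl_br !compBr !compBl !comp_lfunA !opprB.
rewrite (AC ((2*2)*(2*2)*(2*2)) ((1*12)*(7*2)*(3*10)*(5*4)*(11*6)*(9*8))) /=.
by rewrite !subrr !addr0.
Qed.

Definition mx_of k (e : k.-tuple V) x : 'M[F]_k :=
  \matrix_(i, j) coord e i (x e`_j).

Definition gl_tr x : F^o := \tr (mx_of (vbasis {:V}) x).

Lemma gl_trE k (e : k.-tuple V) x : basis_of {:V} e -> gl_tr x = \tr (mx_of e x).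
Proof.
move=> e_basis; rewrite /gl_tr /mxtrace; set b := vbasis _.
have b_basis : basis_of {:V} b := vbasisP _.
transitivity (\sum_i \sum_(j < k) coord b i e`_j * coord e j (x b`_i)).
  apply: eq_bigr => i _; rewrite mxE [x _ in LHS](coord_basis e_basis) ?memvf //.
  rewrite linear_sum; apply: eq_bigr => j _.
  by rewrite linearZ /= mulrC.
rewrite exchange_big /=; apply: eq_bigr => j _.
rewrite mxE [X in x X](coord_basis b_basis) ?memvf // !linear_sum.
by apply: eq_bigr => i _; rewrite !linearZ.
Qed.

Lemma gl_tr_linear : linear gl_tr.
Proof.
move=> a x y; rewrite /gl_tr /mxtrace scaler_sumr -big_split.
by apply: eq_bigr => i _; rewrite !mxE !lfunE /= lfunE linearP.
Qed.
HB.instance Definition _ := GRing.isSemilinear.Build F 'End(V) F^o _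
  gl_tr (GRing.semilinear_linear gl_tr_linear).

Definition slv : {vspace 'End(V)} := lker (linfun gl_tr).
Definition scalv : {vspace 'End(V)} := <[\1%VF]>%VS.

Lemma mem_slv x : (x \in slv) = (gl_tr x == 0).
Proof. by rewrite memv_ker lfunE. Qed.

End GL.

Arguments slv {F} V.
Arguments scalv {F} V.
Arguments gl_br {F V} x y.

Section Tensor.
Variables (F : fieldType) (V : vectType F).
Implicit Types (v w : V) (x : 'End(V)).

(* V (x) V is realised as Hom(V^*, V), with v (x) w := (phi |-> phi(v) w);
   tens_univ is its universal property. *)
Local Notation dual := 'Hom(V, F^o).
Local Notation tensor := 'Hom('Hom(V, F^o), V).
Implicit Types (t : tensor) (U : {vspace tensor}).

Definition tens v w : tensor := linfun (fun phi : dual => (phi v : F) *: w).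

Lemma tensE v w (phi : dual) : tens v w phi = (phi v : F) *: w.
Proof.
rewrite linear_lfunE // => a p q.
by rewrite !lfunE /= lfunE scalerDl scalerA.
Qed.

Lemma tens_bilinear : bilinear2 tens.
Proof.
split=> [v a w1 w2 | w a v1 v2]; apply/lfunP=> phi.
  by rewrite !lfunE /= lfunE /= !tensE scalerDr !scalerA mulrC.
by rewrite !lfunE /= lfunE /= !tensE linearP scalerDl scalerA.
Qed.

Let b := vbasis {:V}.
Let db (i : 'I_(\dim {:V})) : dual := linfun (coord b i : V -> F^o).

Let tens_sum t : t = \sum_(i < \dim {:V}) tens b`_i (t (db i)).
Proof.
apply/lfunP=> phi; rewrite sum_lfunE.
have {1}-> : phi = \sum_(i < \dim {:V}) (phi b`_i : F) *: db i.
  apply/lfunP=> v; rewrite sum_lfunE {1}(coord_vbasis (memvf v)) linear_sum.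
  by apply: eq_bigr => i _; rewrite linearZ lfunE /= lfunE; apply: mulrC.
by rewrite linear_sum; apply: eq_bigr => i _; rewrite linearZ tensE.
Qed.

Lemma tens_univ (W : vectType F) (beta : V -> V -> W) :
  bilinear2 beta ->
  exists! g : 'Hom(tensor, W), forall v w, g (tens v w) = beta v w.
Proof.
move=> [linr linl].
pose g t : W := \sum_(i < \dim {:V}) beta b`_i (t (db i)).
have g_lin : linear g.
  move=> a t u; rewrite /g scaler_sumr -big_split; apply: eq_bigr => i _.
  by rewrite !lfunE /= lfunE linr.
exists (linfun g); split=> [v w | g' g'E].
  rewrite linear_lfunE // [in RHS](coord_vbasis (memvf v)).
  rewrite -(linear_lfunE (linl w)) linear_sum; apply: eq_bigr => i _.
  rewrite linearZ /= linear_lfunE // tensE lfunE.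
  by rewrite -(linear_lfunE (linr _)) linearZ /= linear_lfunE.
apply/lfunP=> t; rewrite linear_lfunE // [in RHS](tens_sum t) linear_sum.
by apply: eq_bigr => i _; rewrite [RHS]g'E.
Qed.

Definition tens_act x t : tensor :=
  (x \o t)%VF + (t \o linfun (fun phi : dual => (phi \o x)%VF))%VF.

Lemma tens_act_tens x v w : tens_act x (tens v w) = tens (x v) w + tens v (x w).
Proof.
apply/lfunP=> phi; rewrite !lfunE /= !lfunE /= !tensE linearZ /= addrC.
rewrite linear_lfunE ?lfunE // => a p q.
by rewrite comp_lfunDl comp_lfunZl.
Qed.

Lemma tens_act_linear x : linear (tens_act x).
Proof.
move=> a t u.
rewrite /tens_act comp_lfunDl comp_lfunDr -comp_lfunZl -comp_lfunZr.
by rewrite addrACA scalerDr.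
Qed.

Definition wedge v w : tensor := tens v w - tens w v.

Definition sym2 : {vspace tensor} :=
  <<[seq tens v v | v <- vbasis {:V}] ++
    [seq (tens v w + tens w v)%R | v <- vbasis {:V}, w <- vbasis {:V}]>>%VS.

Definition ext2 : {vspace tensor} :=
  <<[seq wedge v w | v <- vbasis {:V}, w <- vbasis {:V}]>>%VS.

Lemma sym2_sub U :
  (forall v, tens v v \in U) /\ (forall v w, tens v w + tens w v \in U) <->
  (sym2 <= U)%VS.
Proof.
have [linr linl] := tens_bilinear.
have bil : bilinear2 (fun v w => tens v w + tens w v).
  by split=> [v|v] a w1 w2; rewrite (linr v) (linl v) scalerDr addrACA.
have span := span_bilinear2 bil {:V} {:V} U.
rewrite /sym2 span_cat; split=> [[sq sy] | ].
  rewrite subv_add; apply/andP; split; last by apply/span.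
  by apply/span_subvP=> _ /mapP[v _ ->].
rewrite subv_add => /andP[/span_subvP sq /span sy].
have sy' v w : tens v w + tens w v \in U by apply: sy; apply: memvf.
split=> // v; rewrite (coord_vbasis (memvf v)).
elim/big_ind: _ => [|u w Uu Uw|i _].
- by rewrite -(linear_lfunE (linr 0)) linear0 mem0v.
- have -> : tens (u + w) (u + w)
          = tens u u + tens w w + (tens u w + tens w u).
    rewrite -(linear_lfunE (linr _)) linearD /= !linear_lfunE //.
    rewrite -(linear_lfunE (linl u)) -(linear_lfunE (linl w)) !linearD /=.
    by rewrite !linear_lfunE // addrACA [tens w u + _]addrC addrACA.
  by apply: rpredD (sy' u w); apply: rpredD.
rewrite -(linear_lfunE (linr _)) linearZ rpredZ //= linear_lfunE //.
rewrite -(linear_lfunE (linl _)) linearZ rpredZ //= linear_lfunE //.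
by apply/sq/map_f/mem_nth; rewrite size_tuple.
Qed.

Lemma ext2_sub U : (forall v w, wedge v w \in U) <-> (ext2 <= U)%VS.
Proof.
have [linr linl] := tens_bilinear.
have bil : bilinear2 wedge.
  split=> [v|v] a w1 w2; rewrite /wedge (linr v) (linl v) scalerBr opprD;
    by rewrite addrACA.
have span := span_bilinear2 bil {:V} {:V} U.
by split=> [sub|/span sub v w]; [apply/span | apply: sub; apply: memvf].
Qed.

Lemma sym2_submodule : submodule tens_act sym2.
Proof.
move=> x t; rewrite -(linear_lfunE (tens_act_linear x)) memv_preim.
have /sym2_sub[sq sy] := subvv sym2.
apply/subvP/sym2_sub; split=> [v | v w]; rewrite -memv_preim.
  by rewrite linear_lfunE ?tens_act_tens; last exact: tens_act_linear.
rewrite linearD /= !linear_lfunE ?tens_act_tens; try exact: tens_act_linear.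
by rewrite [tens (x w) v + _]addrC addrACA rpredD.
Qed.

Lemma ext2_submodule : submodule tens_act ext2.
Proof.
move=> x t; rewrite -(linear_lfunE (tens_act_linear x)) memv_preim.
have /ext2_sub mem := subvv ext2.
apply/subvP/ext2_sub => v w; rewrite -memv_preim.
rewrite linearB /= !linear_lfunE ?tens_act_tens; try exact: tens_act_linear.
by rewrite [tens (x w) v + _]addrC opprD addrACA rpredD ?mem.
Qed.

End Tensor.

Arguments sym2 {F} V.
Arguments ext2 {F} V.

Section Form.
Variables (F : fieldType) (V : vectType F) (f : {biscalar V}).
Implicit Types x y : 'End(V).

Definition alternating_form : Prop := forall v, f v v = 0.
Definition nondegenerate_form : Prop :=
  forall v, (forall w, f v w = 0) -> v = 0.

Definition Lf : {vspace 'End(V)} :=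
  lker (linfun (fun x : 'End(V) => linfun (fun v : V =>
    linfun (fun w : V => (f (x v) w + f v (x w) : F^o))))).

Lemma mem_Lf x : x \in Lf <-> forall v w, f (x v) w = - f v (x w).
Proof.
have lin1 y v : linear (fun w : V => (f (y v) w + f v (y w) : F^o)).
  by move=> a w1 w2; rewrite [y (_ + _)]linearP !linearPr scalerDr addrACA.
have lin2 y :
    linear (fun v => linfun (fun w : V => (f (y v) w + f v (y w) : F^o))).
  move=> a v1 v2; apply/lfunP=> w.
  rewrite !lfunE /= lfunE /= !linear_lfunE // [y (_ + _)]linearP !linearPl.
  by rewrite scalerDr addrACA.
have lin3 : linear (fun y : 'End(V) => linfun (fun v : V =>
    linfun (fun w : V => (f (y v) w + f v (y w) : F^o)))).
  move=> a y1 y2; apply/lfunP=> v; apply/lfunP=> w.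
  rewrite [in RHS]add_lfunE [in RHS]scale_lfunE !(linear_lfunE (lin2 _)).
  rewrite [in RHS]add_lfunE [in RHS]scale_lfunE !(linear_lfunE (lin1 _ _)).
  rewrite !add_lfunE !scale_lfunE.
  by rewrite linearPl linearPr scalerDr addrACA.
rewrite memv_ker linear_lfunE //; split=> [/eqP xL v w | xL].
  apply/eqP; rewrite -addr_eq0; apply/eqP.
  have /lfunP/(_ v)/lfunP/(_ w) := xL.
  by rewrite (linear_lfunE (lin2 _)) (linear_lfunE (lin1 _ _)) !zero_lfunE.
apply/eqP/lfunP=> v; apply/lfunP=> w.
rewrite (linear_lfunE (lin2 _)) (linear_lfunE (lin1 _ _)) !zero_lfunE.
by rewrite xL addNr.
Qed.

Definition Lf1 : {vspace 'End(V)} := derv gl_br Lf.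
Definition Lf2 : {vspace 'End(V)} := derv gl_br Lf1.

Definition Lf_gl (x : subvs_of Lf) (y : 'End(V)) : 'End(V) := gl_br (vsval x) y.
Definition Lf_tens (x : subvs_of Lf) := tens_act (vsval x).

Lemma Lf_submodule : submodule Lf_gl Lf.
Proof.
move=> x y /mem_Lf yL; have /mem_Lf xL := subvsP x; apply/mem_Lf => v w.
rewrite /Lf_gl /gl_br !lfunE /= !lfunE /= !lfunE /=.
by rewrite linearBl linearBr /= !xL !yL !xL !opprK opprB.
Qed.

Lemma Lf1_submodule : submodule Lf_gl Lf1.
Proof. by move=> x; exact: (derv_stable (gl_lie V) (@Lf_submodule x)). Qed.

Lemma Lf2_submodule : submodule Lf_gl Lf2.
Proof. by move=> x; exact: (derv_stable (gl_lie V) (@Lf1_submodule x)). Qed.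

Definition heis_br (x y : (V * F^o)%type) : (V * F^o)%type :=
  (0, (f x.1 y.1 : F^o)).

End Form.

Arguments alternating_form {F V} f.
Arguments nondegenerate_form {F V} f.
Arguments Lf_gl {F V} f x y.
Arguments Lf_tens {F V} f x t.
Arguments heis_br {F V} f x y.

Definition trivial_act (F : fieldType) (A : Type) (M : vectType F)
  (a : A) (y : M) : M := 0.

Definition alternating_mx (F : fieldType) (n : nat) (B : 'M[F]_n) : Prop :=
  (forall i j, B i j = - B j i) /\ (forall i, B i i = 0).

(* Main.v *)
(** Let [x^*] be the adjoint of [x] with respect to [f]. In characteristic 2,
    [L(f)] is the set of [x] with [x^* = x], i.e. the kernel of
    [phi(y) = y + y^*], and [phi] is a homomorphism of [L(f)]-modules. With
    [T(v,w) = phi(u |-> f(u,v) w)] and [S_v(u) = f(u,v) v] one has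
    [[x, T(v,w)] = T(xv,w) + T(v,xw)] and [[S_a, x] = T(a, xa)] for [x] in
    [L(f)]; these give [L(f)^(1) = phi(gl)] and [L(f)^(2) = phi(sl)], the latter
    being spanned by the [T(v,w)] with [f(v,w) = 0]. So [phi] induces
    [sl/L(f) = L(f)^(2)], and [sl/U = L(f)^(2)/s] when [4 | m].

    A submodule of [L(f)^(2)] with a nonscalar element [y] contains a nonzero
    [T(a, ya)], and bracketing with the [S_d] moves an isotropic [T(a,b)] to any
    other one. For an ideal of [L(f)^(2)] and [m >= 6], a double bracket of [y]
    with isotropic [T]'s yields some [T(a,b)], which isotropic [T]'s again move
    everywhere. For [m = 4] and a Lagrangian plane spanned by [a, b], the line of
    [T(a,b)] is an ideal modulo scalars. The number of composition factors is
    intrinsic by Jordan-Hoelder, and the tensor square is [gl(V)] through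
    [v (x) w |-> (u |-> f(u,v) w)]. *)
Require Import Defs.
From HB Require Import structures.
From mathcomp Require Import all_boot all_order all_algebra.

Set Implicit Arguments.
Unset Strict Implicit.
Unset Printing Implicit Defensive.

Import GRing.Theory.
Local Open Scope ring_scope.

(** * Subquotients of modules and Lie algebras *)

(** The trace of y is the half-trace of phi(y), that is, the trace of its upper left block. As L(f)
    is the kernel of phi, the trace vanishes on L(f), and the half-trace cuts L(f)^(2) out of
    L(f)^(1) as a hyperplane. The identity has half-trace n, so the scalars lie in L(f)^(2) exactly
    when n is even: this is the origin of the dichotomy on 4 | m. The quotient L(f) / L(f)^(1) is
    read off from the diagonals of B and C, and the half-trace of a bracket is f evaluated at the
    two diagonal vectors, whence the Heisenberg algebra.

    Quotient types live on chosen complements and are awkward to compute in. Each factor is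
    therefore described by a linear map out of the ambient space ([presents], [presents_br]), which
    turns irreducibility, simplicity and isomorphism into statements about subspaces of gl(V). *)

Lemma limg_vsval (F : fieldType) (M : vectType F) (U : {vspace M}) :
  (linfun (vsval : subvs_of U -> M) @: {:subvs_of U} = U)%VS.
Proof.
apply/vspaceP => u; apply/memv_imgP/idP => [[y _ ->]|uU].
  by rewrite lfunE; apply: subvsP.
by exists (vsproj U u); rewrite ?memvf // lfunE /= vsprojK.
Qed.

Section Descend.
Variables (F : fieldType) (M N1 N2 : vectType F).

(** Preimages are taken through the inclusion of U, so p only has to be onto from U. Their choice is
    harmless because h kills the difference of any two. *)
Lemma lfun_factor (p : 'Hom(M, N1)) (h : 'Hom(M, N2)) (U : {vspace M}) :
    (p @: U = fullv)%VS -> {in U, forall u, p u = 0 -> h u = 0} ->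
  exists phi : 'Hom(N1, N2), {in U, forall u, phi (p u) = h u}.
Proof.
move=> p_onto ker_ph; pose i := linfun (vsval : subvs_of U -> M).
have pi_onto : limg (p \o i)%VF = fullv by rewrite limg_comp limg_vsval.
exists (h \o (i \o (p \o i)^-1))%VF => u uU; rewrite !comp_lfunE.
set v := (p \o i)^-1%VF (p u).
have piv : p (i v) = p u.
  by rewrite -[LHS](comp_lfunE p i) limg_lfunVK // pi_onto memvf.
have ivU : i v \in U by rewrite lfunE subvsP.
apply/eqP; rewrite -subr_eq0 -linearB /=; apply/eqP/ker_ph; first exact: rpredB.
by rewrite linearB /= piv subrr.
Qed.

End Descend.

Lemma lfun_factor_bij (F : fieldType) (M N1 N2 : vectType F)
    (p : 'Hom(M, N1)) (h : 'Hom(M, N2)) (U : {vspace M}) :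
    (p @: U = fullv)%VS -> (h @: U = fullv)%VS ->
    {in U, forall u, (p u == 0) = (h u == 0)} ->
  exists phi : 'Hom(N1, N2), bijective phi /\ {in U, forall u, phi (p u) = h u}.
Proof.
move=> p_onto h_onto ker_ph.
have [u Uu /eqP|phi phiE] :=
  lfun_factor p_onto (_ : {in U, forall u, p u = 0 -> h u = 0}).
  by rewrite ker_ph // => /eqP.
have [u Uu /eqP|psi psiE] :=
  lfun_factor h_onto (_ : {in U, forall u, h u = 0 -> p u = 0}).
  by rewrite -ker_ph // => /eqP.
exists phi; split=> //; exists psi => y.
  have /memv_imgP[u uU ->] : y \in (p @: U)%VS by rewrite p_onto memvf.
  by rewrite phiE // psiE.
have /memv_imgP[u uU ->] : y \in (h @: U)%VS by rewrite h_onto memvf.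
by rewrite psiE // phiE.
Qed.

Section Presentation.
Variables (F : fieldType) (A : Type) (M : vectType F) (act : A -> M -> M).
Implicit Types (U W X : {vspace M}).

(* p identifies the module (N, actN) with the subquotient U / W of M *)
Definition presents U W (N : vectType F) (actN : A -> N -> N) (p : 'Hom(M, N)) :=
  [/\ (p @: U = fullv)%VS, {in U, forall u, (p u == 0) = (u \in W)}
    & forall a, {in U, forall u, p (act a u) = actN a (p u)}].

(** Irreducibility of U / W expressed without the quotient type, by comparing subspaces of M. *)
Definition covers W U :=
  [/\ (W <= U)%VS, W != U & forall X, submodule act X -> (W <= X)%VS ->
        (X <= U)%VS -> X = W \/ X = U].

Lemma sub_presents U :
  submodule act U -> presents U 0%VS (sub_act act U) (linfun (vsproj U)).
Proof.
move=> sU; split=> [|u uU|a u uU].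
- apply/vspaceP => y; rewrite memvf; apply/memv_imgP; exists (vsval y).
    exact: subvsP.
  by rewrite lfunE /= vsvalK.
- by rewrite lfunE -(inj_eq (@subvs_inj _ _ U)) /= vsprojK // memv0.
- by rewrite !lfunE /sub_act /= vsprojK.
Qed.

Lemma presents_dim U W N actN p : (W <= U)%VS -> @presents U W N actN p ->
  (\dim {:N} + \dim W)%N = \dim U.
Proof.
move=> sWU [p_onto p_ker _].
rewrite -(limg_ker_dim p U) p_onto addnC; congr (\dim _ + _)%N.
apply/vspaceP => u; rewrite memv_cap memv_ker.
by case: (boolP (u \in U)) => [/p_ker -> //|]; apply: contraNF; apply: (subvP sWU).
Qed.

Lemma presents_iso U W N1 act1 p1 N2 act2 p2 : submodule act U ->
  @presents U W N1 act1 p1 -> @presents U W N2 act2 p2 -> mod_iso act1 act2.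
Proof.
move=> sU [onto1 ker1 equiv1] [onto2 ker2 equiv2].
have [u uU|phi [phi_bij phiE]] := lfun_factor_bij onto1 onto2 (_ : {in U, _}).
  by rewrite ker1 ?ker2.
exists phi; split=> // a y.
have /memv_imgP[u uU ->] : y \in (p1 @: U)%VS by rewrite onto1 memvf.
by rewrite -equiv1 // !phiE ?equiv2 //; apply: sU.
Qed.

(** Correspondence theorem: image and preimage under p match the submodules of N with those between
    W and U. *)
Lemma presents_irr U W N actN p : (W <= U)%VS -> submodule act U ->
  @presents U W N actN p -> irreducible_mod actN <-> covers W U.
Proof.
move=> sWU sU pres; have dimN := presents_dim sWU pres.
have [p_onto p_ker p_equiv] := pres.
split=> [[N0 Nirr] | [_ WneqU cov]].
  split=> // [|X sX sWX sXU].
    by apply: contra N0 => /eqP eqWU; rewrite -dimv_eq0 -(eqn_add2r (\dim W)) dimN eqWU.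
  have sub_pX : submodule actN (p @: X).
    move=> a _ /memv_imgP[u uX ->].
    by rewrite -p_equiv ?(subvP sXU) // memv_img // sX.
  have [pX0|pXf] := Nirr _ sub_pX; [left | right]; apply/eqP.
    rewrite eqEsubv sWX andbT; apply/subvP => u uX.
    by rewrite -p_ker ?(subvP sXU) // -memv0 -pX0 memv_img.
  rewrite eqEsubv sXU; apply/subvP => u uU.
  have /memv_imgP[x xX pux] : p u \in (p @: X)%VS by rewrite pXf memvf.
  rewrite -(subrK x u) rpredD // (subvP sWX) // -p_ker.
    by rewrite linearB /= pux subrr.
  by rewrite rpredB // (subvP sXU).
split=> [|Y sY].
  rewrite -dimv_eq0 -(eqn_add2r (\dim W)) dimN add0n.
  by apply: contra WneqU => /eqP eqd; rewrite eqEdim sWU eqd leqnn.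
(* Nothing is known about p outside U, so the preimage is cut down to U. *)
pose X := (U :&: p @^-1: Y)%VS.
have pX : (p @: X = Y)%VS.
  apply/vspaceP => y; apply/memv_imgP/idP => [[u /memv_capP[_]] + ->|yY].
    by rewrite memv_preim.
  have /memv_imgP[u uU yE] : y \in (p @: U)%VS by rewrite p_onto memvf.
  by exists u; rewrite // memv_cap uU -memv_preim -yE.
have [|||XW|XU] := cov X.
- move=> a u /memv_capP[uU]; rewrite -!memv_preim => puY.
  by rewrite memv_cap sU //= -memv_preim p_equiv // sY.
- rewrite subv_cap sWU; apply/subvP => u uW; rewrite -memv_preim.
  by have /eqP -> : p u == 0; rewrite ?mem0v // p_ker // (subvP sWU).
- exact: capvSl.
- left; apply/eqP; rewrite -subv0 -pX XW; apply/subvP => _ /memv_imgP[u uW ->].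
  by rewrite memv0 p_ker // (subvP sWU).
- by right; rewrite -pX XU.
Qed.

Lemma presents_trivial U W N actN p : (W <= U)%VS -> submodule act U ->
  @presents U W N actN p ->
  trivial_factor actN <->
  \dim U = (\dim W).+1 /\ forall a u, u \in U -> act a u \in W.
Proof.
move=> sWU sU pres; have dimN := presents_dim sWU pres.
have [p_onto p_ker p_equiv] := pres; split=> -[dim1 triv].
  split=> [|a u uU]; first by rewrite -dimN dim1.
  by rewrite -p_ker ?sU // p_equiv // triv.
split=> [|a y]; first by apply/eqP; rewrite -(eqn_add2r (\dim W)) dimN dim1.
have /memv_imgP[u uU ->] : y \in (p @: U)%VS by rewrite p_onto memvf.
by apply/eqP; rewrite -p_equiv // p_ker ?triv ?sU.
Qed.

End Presentation.

Section PresentationTransfer.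
Variables (F : fieldType) (A : Type).

(** Pulls a presentation back along an equivariant g. With g = [symm] it relates quotients of sl(V)
    to L(f)^(2); with g = [tens_endo] it relates tensor squares to subspaces of gl(V). *)
Lemma presents_comp (M1 M2 N : vectType F) (act1 : A -> M1 -> M1)
    (act2 : A -> M2 -> M2) (actN : A -> N -> N) (U1 W1 : {vspace M1})
    (U2 W2 : {vspace M2}) (g : 'Hom(M1, M2)) (p : 'Hom(M2, N)) :
    presents act2 U2 W2 actN p -> (g @: U1 = U2)%VS ->
    {in U1, forall u, (g u \in W2) = (u \in W1)} ->
    (forall a, {in U1, forall u, g (act1 a u) = act2 a (g u)}) ->
  presents act1 U1 W1 actN (p \o g)%VF.
Proof.
move=> [onto ker equiv] gU gW g_equiv.
have gU2 u : u \in U1 -> g u \in U2 by move=> uU; rewrite -gU memv_img.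
split=> [|u uU|a u uU]; rewrite ?comp_lfunE.
- by rewrite limg_comp gU.
- by rewrite ker ?gU2 ?gW.
- by rewrite g_equiv // equiv ?gU2.
Qed.

Lemma quo_presents (M : vectType F) (act : A -> M -> M) (W : {vspace M}) :
    (forall a, linear (act a)) -> submodule act W ->
  presents act fullv W (quo_act act W) (linfun (@quo_pi F M W)).
Proof.
move=> lin sW; split=> [|u _|a u _]; rewrite ?lfunE ?quo_pi_eq0 //=.
  apply/vspaceP => y; rewrite memvf; apply/memv_imgP.
  by exists (quo_repr y); rewrite ?memvf // lfunE /= quo_reprK.
by rewrite quo_act_pi // lfunE.
Qed.

Lemma sub_act_linear (M : vectType F) (act : A -> M -> M) (U : {vspace M}) a :
  linear (act a) -> linear (sub_act act U a).
Proof. by move=> lin k u v; rewrite /sub_act !linearP lin linearP. Qed.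

Definition fproj (M : vectType F) (W U : {vspace M}) : 'Hom(M, subquov W U) :=
  (linfun (@quo_pi F _ (restrv U W)) \o linfun (vsproj U))%VF.

Lemma factor_presents (M : vectType F) (act : A -> M -> M) (W U : {vspace M}) :
    (forall a, linear (act a)) -> submodule act W -> submodule act U ->
  presents act U W (factor_act act W U) (fproj W U).
Proof.
move=> lin sW sU; have [onto _ equiv] := sub_presents sU.
apply: presents_comp onto _ equiv.
  apply: quo_presents => [a|a u]; first exact/sub_act_linear/lin.
  by rewrite !mem_restrv sub_actE //; apply: sW.
by move=> u uU; rewrite lfunE mem_restrv /= vsprojK.
Qed.

End PresentationTransfer.

Section LiePresentation.
Variables (F : fieldType) (L : vectType F) (br : L -> L -> L).
Implicit Types (U W I : {vspace L}).

Definition presents_br U W (K : vectType F) (brK : K -> K -> K)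
    (p : 'Hom(L, K)) :=
  [/\ (p @: U = fullv)%VS, {in U, forall u, (p u == 0) = (u \in W)}
    & {in U &, forall u v, p (br u v) = brK (p u) (p v)}].

Definition br_closed U := {in U &, forall u v, br u v \in U}.

Hypothesis br_lie : lie_algebra br.

Lemma presents_br_lie U W K brK p :
  br_closed U -> @presents_br U W K brK p -> lie_algebra brK.
Proof.
move=> clU [onto _ hom]; have [[linr linl] alt jac] := br_lie.
have lift y : exists2 u, u \in U & y = p u.
  by apply/memv_imgP; rewrite onto memvf.
split; first split.
- move=> y a y1 y2.
  have [[[u uU ->] [u1 uU1 ->]] [u2 uU2 ->]] := (lift y, lift y1, lift y2).
  by rewrite -linearP -!hom ?rpredD ?rpredZ // linr linearP.
- move=> y a y1 y2.
  have [[[u uU ->] [u1 uU1 ->]] [u2 uU2 ->]] := (lift y, lift y1, lift y2).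
  by rewrite -linearP -!hom ?rpredD ?rpredZ // linl linearP.
- by move=> y; have [u uU ->] := lift y; rewrite -hom // alt linear0.
move=> y y1 y2.
have [[[u uU ->] [u1 uU1 ->]] [u2 uU2 ->]] := (lift y, lift y1, lift y2).
by rewrite -!hom ?clU // -!linearD jac linear0.
Qed.

Lemma sub_presents_br U :
  br_closed U -> presents_br U 0%VS (sub_br br U) (linfun (vsproj U)).
Proof.
move=> clU; split=> [|u uU|u v uU vU].
- apply/vspaceP => y; rewrite memvf; apply/memv_imgP; exists (vsval y).
    exact: subvsP.
  by rewrite lfunE /= vsvalK.
- by rewrite lfunE -(inj_eq (@subvs_inj _ _ U)) /= vsprojK // memv0.
- by rewrite !lfunE /sub_br /= !vsprojK.
Qed.

Lemma presents_br_iso U W K1 br1 p1 K2 br2 p2 : br_closed U ->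
  @presents_br U W K1 br1 p1 -> @presents_br U W K2 br2 p2 -> lie_iso br1 br2.
Proof.
move=> clU [onto1 ker1 hom1] [onto2 ker2 hom2].
have [u uU|phi [phi_bij phiE]] := lfun_factor_bij onto1 onto2 (_ : {in U, _}).
  by rewrite ker1 ?ker2.
exists phi; split=> // y z.
have /memv_imgP[u uU ->] : y \in (p1 @: U)%VS by rewrite onto1 memvf.
have /memv_imgP[v vU ->] : z \in (p1 @: U)%VS by rewrite onto1 memvf.
by rewrite -hom1 // !phiE ?hom2 ?clU.
Qed.

(** Correspondence theorem for ideals; stability of X is only asked under U, not under all of L. *)
Lemma presents_br_simple U W K brK p : (W <= U)%VS -> br_closed U ->
  @presents_br U W K brK p ->
  lie_simple brK <->
  (1 < \dim U - \dim W)%N /\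
  forall X, (W <= X)%VS -> (X <= U)%VS ->
    {in U & X, forall u v, br u v \in X} -> X = W \/ X = U.
Proof.
move=> sWU clU pres; have lieK := presents_br_lie clU pres.
have dimN : (\dim {:K} = \dim U - \dim W)%N.
  (* With an empty set of operators equivariance is vacuous, so the dimension formula for modules
     applies. *)
  have triv : presents (fun (_ : void) (u : L) => u) U W (fun _ y => y) p.
    by case: pres => *; split=> // -[].
  by rewrite -(presents_dim sWU triv) addnK.
have [p_onto p_ker hom] := pres.
split=> [[_ dimK simp] | [dimU simp]].
  split=> [|X sWX sXU idX]; first by rewrite -dimN.
  have [|pX0|pXf] := simp (p @: X)%VS.
  - move=> y _ /memv_imgP[v vX ->].
    have /memv_imgP[u uU ->] : y \in (p @: U)%VS by rewrite p_onto memvf.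
    by rewrite -hom //; [apply/memv_img/idX | apply: (subvP sXU)].
  - left; apply/eqP; rewrite eqEsubv sWX andbT; apply/subvP => u uX.
    by rewrite -p_ker ?(subvP sXU) // -memv0 -pX0 memv_img.
  right; apply/eqP; rewrite eqEsubv sXU; apply/subvP => u uU.
  have /memv_imgP[x xX pux] : p u \in (p @: X)%VS by rewrite pXf memvf.
  rewrite -(subrK x u) rpredD // (subvP sWX) // -p_ker.
    by rewrite linearB /= pux subrr.
  by rewrite rpredB // (subvP sXU).
split; rewrite ?dimN // => Y idY.
pose X := (U :&: p @^-1: Y)%VS.
have pX : (p @: X = Y)%VS.
  apply/vspaceP => y; apply/memv_imgP/idP => [[u /memv_capP[_]] + ->|yY].
    by rewrite memv_preim.
  have /memv_imgP[u uU yE] : y \in (p @: U)%VS by rewrite p_onto memvf.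
  by exists u; rewrite // memv_cap uU -memv_preim -yE.
have [|||XW|XU] := simp X.
- rewrite subv_cap sWU; apply/subvP => u uW; rewrite -memv_preim.
  by have /eqP -> : p u == 0; rewrite ?mem0v // p_ker // (subvP sWU).
- exact: capvSl.
- move=> u v uU /memv_capP[vU]; rewrite -!memv_preim => pvY.
  by rewrite memv_cap clU //= -memv_preim hom // idY.
- left; apply/eqP; rewrite -subv0 -pX XW; apply/subvP => _ /memv_imgP[u uW ->].
  by rewrite memv0 p_ker // (subvP sWU).
- by right; rewrite -pX XU.
Qed.

End LiePresentation.

Lemma factor_presents_br (F : fieldType) (L : vectType F) (br : L -> L -> L)
    (U W : {vspace L}) :
    lie_algebra br -> br_closed br U -> {in U & W, forall u v, br u v \in W} ->
  presents_br br U W (factor_br br W U) (fproj W U).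
Proof.
move=> br_lie clU idW.
have sub_pres := sub_presents_br clU.
have sub_lie := presents_br_lie br_lie clU sub_pres.
have [onto ker hom] := sub_pres.
rewrite /fproj; split=> [|u uU|u v uU vU]; rewrite ?comp_lfunE.
- rewrite limg_comp onto; apply/vspaceP => y; rewrite memvf; apply/memv_imgP.
  by exists (quo_repr y); rewrite ?memvf // lfunE /= quo_reprK.
- by rewrite !lfunE /= quo_pi_eq0 mem_restrv vsprojK.
rewrite hom // ?comp_lfunE /factor_br.
rewrite ![linfun (@quo_pi _ _ _) _]lfunE /= quo_br_pi // => x y.
by rewrite !mem_restrv vsprojK ?clU ?subvsP // => yW; apply: idW; rewrite ?subvsP.
Qed.

(** * Composition series *)

Section JordanHolder.
Variables (F : fieldType) (A : Type) (M : vectType F) (act : A -> M -> M).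
Hypothesis act_lin : forall a, linear (act a).
Implicit Types (U W X N : {vspace M}) (s : seq {vspace M}).

(** A relation and not a function: before [comp_length_min], two chains up to the same U might
    differ in length. *)
Inductive comp_length : nat -> {vspace M} -> Prop :=
| comp_length0 : comp_length 0 0%VS
| comp_lengthS k W U : comp_length k W -> submodule act U -> covers act W U ->
    comp_length k.+1 U.

Lemma submodule0 : submodule act 0%VS.
Proof.
move=> a u; rewrite memv0 => /eqP ->.
by rewrite -(linear_lfunE (act_lin a)) linear0 mem0v.
Qed.

Lemma submoduleD U W : submodule act U -> submodule act W -> submodule act (U + W)%VS.
Proof.
move=> sU sW a _ /memv_addP[u uU [w wW ->]].
rewrite -(linear_lfunE (act_lin a)) linearD /= !linear_lfunE //.
by rewrite memv_add ?sU ?sW.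
Qed.

Lemma submodule_cap U W :
  submodule act U -> submodule act W -> submodule act (U :&: W)%VS.
Proof.
by move=> sU sW a u /memv_capP[uU uW]; rewrite memv_cap sU ?sW.
Qed.

Lemma comp_length_submodule k U : comp_length k U -> submodule act U.
Proof. by case=> //; apply: submodule0. Qed.

(** The chain of U is intersected with N, and each step either collapses or remains a cover. If none
    collapses then N = U, which makes the induction in [comp_length_min] strict. *)
Lemma comp_length_sub k U N : comp_length k U -> submodule act N -> (N <= U)%VS ->
  exists j, [/\ (j <= k)%N, comp_length j N & j = k -> N = U].
Proof.
move=> kU; elim: kU N => {k U} [|k W U kW IHk sU [sWU neqWU cov]] N sN sNU.
  exists 0%N; move: sNU; rewrite subv0 => /eqP ->; split=> //; exact: comp_length0.
have sW := comp_length_submodule kW.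
have [j [lejk jNW eqjk]] := IHk _ (submodule_cap sN sW) (capvSr _ _).
have [eqNW|neqNW] := eqVneq (N :&: W)%VS N.
  exists j; split; first exact: leqW.
    by rewrite -eqNW.
  by move=> eqjS; move: lejk; rewrite eqjS ltnn.
(* By the modular law X is recovered from X + W, which is W or U. *)
have cov' : covers act (N :&: W) N.
  split=> [||X sX sNWX sXN]; rewrite ?capvSl //.
  have [||XW|XU] := cov (X + W)%VS (submoduleD sX sW).
  - exact: addvSr.
  - by rewrite subv_add sWU (subv_trans sXN).
  - left; apply/eqP; rewrite eqEsubv sNWX andbT subv_cap sXN /= -XW.
    exact: addvSl.
  right; apply/eqP; rewrite eqEsubv sXN; apply/subvP => u uN.
  have /memv_addP[x xX [w wW uE]] : u \in (X + W)%VS by rewrite XU (subvP sNU).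
  rewrite uE rpredD // (subvP sNWX) // memv_cap wW andbT.
  by rewrite -(addKr x w) -uE rpredD // rpredN (subvP sXN).
exists j.+1; split=> //; first exact: comp_lengthS jNW sN cov'.
case=> /eqjk /eqP; rewrite eqEsubv => /andP[_ sWNW].
have sWN : (W <= N)%VS by apply: subv_trans sWNW (capvSl _ _).
have [NW|//] := cov _ sN sWN sNU.
by case/eqP: neqNW; rewrite NW capvv.
Qed.

(** The term just below U in the first chain is proper in U, so the second chain gives it a length
    smaller than k. Only lengths are compared; factors are never matched. *)
Lemma comp_length_min j k U : comp_length j U -> comp_length k U -> (j <= k)%N.
Proof.
move=> jU; elim: jU k => {j U} [|j W U jW IHj sU [sWU neqWU _]] k kU //.
have sW := comp_length_submodule jW.
have [i [leik iW eqik]] := comp_length_sub kU sW sWU.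
apply: leq_ltn_trans (IHj _ iW) _; rewrite ltn_neqAle leik andbT.
by apply: contra neqWU => /eqP /eqik ->.
Qed.

Lemma composition_series_length s :
  composition_series act s -> comp_length (size (factors s)) fullv.
Proof.
case=> s0 s1 sub_s irr; case: s => [|U s] in s0 s1 sub_s irr *.
  rewrite /= in s0 s1; rewrite -s1; exact: comp_length0.
rewrite /= in s0 s1; rewrite -s1.
(* For the induction along the list, the series may start at any U already reached by k covers. *)
suff gen k : comp_length k U ->
    comp_length (k + size (factors (U :: s)))%N (last U s).
  by apply: (gen 0%N); rewrite s0; apply: comp_length0.
elim: s U sub_s irr k {s0 s1} => [|U' s IHs] U sub_s irr k kU.
  by rewrite addn0.
have [/= sUU' irrUU'] := irr (U, U') (mem_head _ _).
have sU : submodule act U by apply: sub_s; rewrite mem_head.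
have sU' : submodule act U' by apply: sub_s; rewrite !inE eqxx orbT.
rewrite /= addnS -addSn; apply: IHs.
- by move=> X sX; apply: sub_s; rewrite inE sX orbT.
- by move=> WU WUs; apply: irr; rewrite inE WUs orbT.
apply: (comp_lengthS kU sU').
exact/(presents_irr sUU' sU' (factor_presents act_lin sU sU')).
Qed.

Lemma composition_series_unique s :
  composition_series act s -> has_composition_factors act (size (factors s)).
Proof.
move=> cs; split; first by exists s.
move=> t ct; apply/eqP; rewrite eqn_leq.
by rewrite !(@comp_length_min _ _ fullv) //; apply: composition_series_length.
Qed.

End JordanHolder.

Lemma covers_dim (F : fieldType) (A : Type) (M : vectType F) (act : A -> M -> M)
    (W U : {vspace M}) :
  (W <= U)%VS -> \dim U = (\dim W).+1 -> covers act W U.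
Proof.
move=> sWU dimU; split=> // [|X _ sWX sXU].
  by apply/eqP => eqWU; move/eqP: dimU; rewrite eqWU eqn_leq ltnn andbF.
have [leWX|ltWX] := leqP (\dim X) (\dim W).
  by left; apply/esym/eqP; rewrite eqEdim sWX.
by right; apply/eqP; rewrite eqEdim sXU dimU.
Qed.

Lemma mem_factors (F : fieldType) (M : vectType F) (s : seq {vspace M}) WU :
  WU \in factors s -> WU.1 \in s /\ WU.2 \in s.
Proof.
case: s => [|U s] //; elim: s U => [|U' s IHs] U //=; rewrite inE.
case/predU1P=> [-> /=|/IHs[/= U1 U2]]; first by rewrite !inE !eqxx !orbT.
by split; rewrite inE ?U1 ?U2 orbT.
Qed.

Lemma factors_cat (F : fieldType) (M : vectType F) U (s1 s2 : seq {vspace M}) :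
  factors (U :: s1 ++ s2) = factors (U :: s1) ++ factors (last U s1 :: s2).
Proof. by elim: s1 U => //= U' s1 IHs U; congr cons; apply: IHs. Qed.

Lemma size_factors (F : fieldType) (M : vectType F) U (s : seq {vspace M}) :
  size (factors (U :: s)) = size s.
Proof. by rewrite size_zip /= (minn_idPr (leqnSn _)). Qed.

(** [big] lists the factors whose irreducibility needs an argument; all others have dimension one
    and zero action. The strict dimension bound prevents members of [big] from being trivial. *)
Lemma composition_series_mixed (F : fieldType) (A : Type) (M : vectType F)
    (act : A -> M -> M) (s : seq {vspace M}) (big : seq ({vspace M} * {vspace M})) :
    (forall a, linear (act a)) -> head fullv s = 0%VS -> last 0%VS s = fullv ->
    {in s, forall U, submodule act U} ->
    {in big, forall WU,
      covers act WU.1 WU.2 /\ ((\dim WU.1).+1 < \dim WU.2)%N} ->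
    {in factors s, forall WU, WU \in big \/
      [/\ (WU.1 <= WU.2)%VS, \dim WU.2 = (\dim WU.1).+1
        & forall a u, u \in WU.2 -> act a u \in WU.1]} ->
  composition_series act s /\
  {in factors s, forall WU,
    trivial_factor (factor_act act WU.1 WU.2) <-> WU \notin big}.
Proof.
move=> lin s0 s1 sub_s big_cov fac.
have fac_cov WU : WU \in factors s -> covers act WU.1 WU.2.
  by case/fac => [/big_cov[] | [sWU dimU _]] //; apply: covers_dim.
split.
  split=> // WU WUs; have cov := fac_cov _ WUs; have [sWU _ _] := cov.
  have [sW sU] := mem_factors WUs; split=> //.
  have pres := factor_presents lin (sub_s _ sW) (sub_s _ sU).
  exact/(presents_irr sWU (sub_s _ sU) pres).
move=> WU WUs; have [sWU _ _] := fac_cov _ WUs.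
have [sW sU] := mem_factors WUs.
have trivP := presents_trivial sWU (sub_s _ sU)
  (factor_presents lin (sub_s _ sW) (sub_s _ sU)).
split=> [/trivP[dimU _] | WUbig].
  by apply/negP => /big_cov[_]; rewrite dimU ltnn.
by have [WUbig'|[_ dimU triv]] := fac _ WUs; [rewrite WUbig' in WUbig | apply/trivP].
Qed.

(** * Strictly increasing chains of subspaces *)

Section Chains.
Variables (F : fieldType) (M : vectType F).
Implicit Types (A B : {vspace M}) (t : seq {vspace M}).

Lemma proper_subv_dim A B : proper_subv A B -> (\dim A < \dim B)%N.
Proof.
case/andP=> sAB neqAB; rewrite ltn_neqAle dimvS // andbT.
by apply: contra neqAB => /eqP eqd; rewrite eqEdim sAB eqd leqnn.
Qed.

(** k counts interior terms, so there are k + 1 steps, each adjoining one vector. *)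
Lemma strict_chain_exists A B k : (A <= B)%VS -> \dim B = (\dim A + k.+1)%N ->
  exists t, strict_chain A B t k.
Proof.
elim: k A => [|k IHk] A sAB dimB.
  exists [::]; rewrite /strict_chain /= /proper_subv sAB andbT /=.
  by apply/eqP => eqAB; move: dimB; rewrite eqAB -[LHS]addn0 => /addnI.
have /subvPn[v vB vA] : ~~ (B <= A)%VS.
  by apply/negP => /dimvS; rewrite dimB leqNgt addnS ltnS leq_addr.
have sA'B : (A + <[v]> <= B)%VS by rewrite subv_add sAB -memvE.
have dimA' : \dim (A + <[v]>) = (\dim A).+1.
  have v0 : v != 0 by apply: contraNneq vA => ->; rewrite mem0v.
  rewrite dimv_disjoint_sum ?dim_vline ?v0 ?addn1 //.
  apply/eqP; rewrite -subv0; apply/subvP => u /memv_capP[+ /vlineP[c uE]]; rewrite uE.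
  have [->|c0] := eqVneq c 0; first by rewrite scale0r !mem0v.
  by rewrite rpredZeq (negPf c0) (negPf vA).
have [|t /andP[/eqP sz_t path_t]] := IHk _ sA'B; first by rewrite dimA' dimB addSnnS.
exists ((A + <[v]>)%VS :: t); rewrite /strict_chain /= sz_t eqxx path_t andbT.
rewrite /proper_subv addvSl; apply: contraNneq vA => ->.
by rewrite (subvP (addvSr _ _)) ?memv_line.
Qed.

Lemma strict_chain_sub A B t k :
  strict_chain A B t k -> (A <= B)%VS /\ (\dim A + k < \dim B)%N.
Proof.
elim: t A k => [|C t IHt] A [|k]; rewrite /strict_chain //=.
  by rewrite andbT addn0 => AB; split; [case/andP: AB | apply: proper_subv_dim].
case/and3P=> sz_t AC path_t; have [|sCB dimB] := IHt C k.
  by rewrite /strict_chain -eqSS sz_t path_t.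
split; first by case/andP: AC => sAC _; apply: subv_trans sCB.
by rewrite addnS -addSn; apply: leq_ltn_trans dimB; rewrite leq_add2r proper_subv_dim.
Qed.

Lemma strict_chain_mem A B t k X :
  strict_chain A B t k -> X \in t -> (A <= X)%VS /\ (X <= B)%VS.
Proof.
elim: t A k => [|C t IHt] A [|k] //; rewrite /strict_chain /= => /and3P[sz_t AC path_t].
have chain_t : strict_chain C B t k by rewrite /strict_chain -eqSS sz_t path_t.
have [sCB _] := strict_chain_sub chain_t; have [sAC _] := andP AC.
rewrite inE => /predU1P[-> //|/(IHt _ _ chain_t)[sCX sXB]].
by split; rewrite ?(subv_trans sAC).
Qed.

(** The k + 1 strict inclusions share exactly k + 1 dimensions, so each of them takes one. *)
Lemma strict_chain_factors A B t k WU :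
    strict_chain A B t k -> \dim B = (\dim A + k.+1)%N ->
    WU \in factors (A :: rcons t B) ->
  [/\ (A <= WU.1)%VS, (WU.1 <= WU.2)%VS, (WU.2 <= B)%VS
    & \dim WU.2 = (\dim WU.1).+1].
Proof.
elim: t A k => [|C t IHt] A [|k]; rewrite /strict_chain //=.
  rewrite andbT inE => /andP[sAB _] dimB /eqP -> /=.
  by rewrite subvv sAB dimB addn1.
move=> chain dimB; have [sz_t /andP[AC path_t]] := andP chain.
have chain_t : strict_chain C B t k by rewrite /strict_chain -eqSS sz_t path_t.
have [sCB leCB] := strict_chain_sub chain_t.
have dimC : \dim C = (\dim A).+1.
  apply/eqP; rewrite eqn_leq proper_subv_dim // andbT.
  by move: leCB; rewrite dimB !addnS ltnS -addSn leq_add2r.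
have [sAC _] := andP AC; rewrite inE => /orP[/eqP -> //=|].
case/(IHt _ _ chain_t); first by rewrite dimB dimC addSnnS.
by move=> sC *; split=> //; apply: subv_trans sC.
Qed.

End Chains.

(** * Alternating forms in characteristic two *)

Section CharTwo.
Variables (F : fieldType) (charF2 : 2%N \in [pchar F]) (W : lmodType F).

Lemma addvv_char2 (x : W) : x + x = 0.
Proof. by rewrite -mulr2n -scaler_nat (pcharf0 charF2) scale0r. Qed.

Lemma oppv_char2 (x : W) : - x = x.
Proof. by apply/eqP; rewrite eq_sym -addr_eq0 addvv_char2. Qed.

Lemma subv_char2 (x y : W) : x - y = x + y.
Proof. by rewrite oppv_char2. Qed.

Lemma addv_eq0_char2 (x y : W) : (x + y == 0) = (x == y).
Proof. by rewrite -subv_char2 subr_eq0. Qed.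

End CharTwo.

(** Off-diagonal terms cancel in pairs; in [half_tr_br] this is what leaves only diagonals. *)
Lemma sum_symmetric (F : fieldType) (charF2 : 2%N \in [pchar F]) n
    (g : 'I_n -> 'I_n -> F) :
  (forall i j, g i j = g j i) -> \sum_i \sum_j g i j = \sum_i g i i.
Proof.
elim: n g => [|n IHn] g gC; first by rewrite !big_ord0.
rewrite big_ord_recl [in RHS]big_ord_recl big_ord_recl -addrA; congr (_ + _).
under [X in _ + X]eq_bigr do rewrite big_ord_recl gC.
by rewrite big_split addrA addrr_pchar2 // add0r IHn.
Qed.

Section Symplectic.
Variables (F : fieldType) (charF2 : 2%N \in [pchar F]) (V : vectType F).
Variables (f : {biscalar V}) (f_alt : alternating_form f).
Hypothesis f_nondeg : nondegenerate_form f.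
Implicit Types (u v w a b c d : V) (x y z : 'End(V)) (k : F).

Lemma formDl u v w : f (u + v) w = f u w + f v w. Proof. exact: linearDl. Qed.
Lemma formDr u v w : f u (v + w) = f u v + f u w. Proof. exact: linearDr. Qed.
Lemma formZl k u v : f (k *: u) v = k * f u v. Proof. exact: linearZl_LR. Qed.
Lemma formZr k u v : f u (k *: v) = k * f u v. Proof. exact: linearZr_LR. Qed.
Lemma form0l v : f 0 v = 0. Proof. exact: linear0l. Qed.
Lemma formC u v : f u v = f v u.
Proof.
apply/eqP; rewrite -subr_eq0 GRing.subr_pchar2 //; apply/eqP.
by have := f_alt (u + v); rewrite formDl !formDr !f_alt addr0 add0r.
Qed.

(** The isomorphism from V to its dual given by f. *)
Definition flat : 'Hom(V, 'Hom(V, F^o)) :=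
  linfun (fun v => linfun (fun w => (f v w : F^o))).

Lemma flatE v w : flat v w = f v w.
Proof.
have lin1 u : linear (fun w => (f u w : F^o)).
  by move=> k u1 u2; rewrite formDr formZr.
rewrite linear_lfunE ?linear_lfunE // => k u1 u2; apply/lfunP => t.
by rewrite add_lfunE scale_lfunE !linear_lfunE // formDl formZl.
Qed.

Lemma lker_flat : lker flat == 0%VS.
Proof.
rewrite -subv0; apply/subvP => v; rewrite memv_ker memv0 => /eqP v0.
by apply/eqP/f_nondeg => w; rewrite -flatE v0 zero_lfunE.
Qed.

Lemma flatVK : cancel flat^-1%VF flat.
Proof.
move=> phi; rewrite limg_lfunVK //.
suff -> : limg flat = fullv by rewrite memvf.
apply/eqP; rewrite eqEdim subvf limg_dim_eq ?(eqP lker_flat) ?capv0 //.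
by rewrite !dimvf /dim /= muln1.
Qed.

Lemma form_represents (phi : 'Hom(V, F^o)) : exists u, forall v, f v u = phi v.
Proof. by exists (flat^-1%VF phi) => v; rewrite formC -flatE flatVK. Qed.

Lemma form_ext u v : (forall w, f w u = f w v) -> u = v.
Proof.
move=> eq_uv; apply/eqP; rewrite -subr_eq0; apply/eqP/f_nondeg => w.
by rewrite formC linearBr /= eq_uv subrr.
Qed.

(** Some coordinate of V / W is nonzero at the class of u; rescaled to be 1 there, it is a
    functional that f represents. Most auxiliary vectors below come from here. *)
Lemma form_separates (W : {vspace V}) u : u \notin W ->
  exists2 c, (forall w, w \in W -> f w c = 0) & f u c = 1.
Proof.
rewrite -quo_pi_eq0 => pu0; pose y := quo_pi W u.
have [i ci0] : exists i, coord (vbasis fullv) i y != 0.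
  apply/existsP; apply: contraNT pu0; rewrite negb_exists => /forallP ci0; apply/eqP.
  rewrite -[quo_pi W u]/y (coord_vbasis (memvf y)) big1 // => i _.
  by have /negPn/eqP -> := ci0 i; rewrite scale0r.
pose phi v : F^o := (coord (vbasis fullv) i y)^-1 * coord (vbasis fullv) i (quo_pi W v).
have phi_lin : linear phi.
  by move=> k v w; rewrite /phi linearP linearD linearZ /= mulrDr mulrCA.
have [c cE] := form_represents (linfun phi); exists c => [w|].
  rewrite cE linear_lfunE // -quo_pi_eq0 => /eqP; rewrite /phi => ->.
  by rewrite linear0 mulr0.
by rewrite cE linear_lfunE // /phi mulVf.
Qed.

(** * Adjoints and self-adjoint operators *)

Definition adj x : 'End(V) :=
  (flat^-1 \o linfun (fun phi : 'Hom(V, F^o) => (phi \o x)%VF) \o flat)%VF.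

Lemma form_adj x u v : f (adj x u) v = f u (x v).
Proof.
have lin : linear (fun phi : 'Hom(V, F^o) => (phi \o x)%VF).
  by move=> k p q; rewrite comp_lfunDl comp_lfunZl.
by rewrite !comp_lfunE -flatE flatVK linear_lfunE // comp_lfunE flatE.
Qed.

Lemma adjP x y : (forall u v, f (y u) v = f u (x v)) -> adj x = y.
Proof.
move=> yE; apply/lfunP => u; apply: form_ext => w.
by rewrite formC form_adj -yE formC.
Qed.

Lemma adjK : involutive adj.
Proof. by move=> x; apply: adjP => u v; rewrite formC -form_adj formC. Qed.

Lemma adj_linear : linear adj.
Proof.
move=> k x y; apply: adjP => u v.
by rewrite !add_lfunE !scale_lfunE formDl formDr formZl formZr !form_adj.
Qed.
HB.instance Definition _ := GRing.isSemilinear.Build F 'End(V) 'End(V) _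
  adj (GRing.semilinear_linear adj_linear).

Lemma adj_comp x y : adj (x \o y)%VF = (adj y \o adj x)%VF.
Proof. by apply: adjP => u v; rewrite comp_lfunE [in RHS]comp_lfunE !form_adj. Qed.

Lemma mem_LfE x : (x \in Lf f) = (adj x == x).
Proof.
apply/idP/eqP => [/mem_Lf xL | xE].
  by apply: adjP => u v; rewrite xL oppr_pchar2.
by apply/mem_Lf => u v; rewrite oppr_pchar2 // -[in LHS]xE form_adj.
Qed.

Lemma Lf_form x u v : x \in Lf f -> f (x u) v = f u (x v).
Proof. by rewrite mem_LfE => /eqP xE; rewrite -[in LHS]xE form_adj. Qed.

Lemma Lf_symmetric x u v : x \in Lf f -> f (x u) v = f (x v) u.
Proof. by move=> xL; rewrite Lf_form // formC. Qed.

(* The L(f)-equivariant map behind every isomorphism of gl(V)-subquotients below: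
   its kernel is L(f), and it maps gl(V) onto L(f)^(1) and sl(V) onto L(f)^(2). *)
Definition symm : 'End('End(V)) := linfun (fun x => x + adj x).

Lemma symmE x : symm x = x + adj x.
Proof.
by rewrite linear_lfunE // => k y z; rewrite linearP scalerDr addrACA.
Qed.

Lemma symm_eq0 x : (symm x == 0) = (x \in Lf f).
Proof. by rewrite symmE addv_eq0_char2 // eq_sym mem_LfE. Qed.

Lemma symm_Lf x : symm x \in Lf f.
Proof. by rewrite mem_LfE symmE linearD /= adjK addrC. Qed.

Lemma gl_brE x y : gl_br x y = (x \o y)%VF + (y \o x)%VF.
Proof. exact: subv_char2. Qed.

Lemma gl_br_app x y u : gl_br x y u = x (y u) + y (x u).
Proof. by rewrite gl_brE lfunE /= !lfunE. Qed.

Lemma gl_brC x y : gl_br x y = gl_br y x.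
Proof. by rewrite !gl_brE addrC. Qed.

Lemma gl_brDr x y z : gl_br x (y + z) = gl_br x y + gl_br x z.
Proof. by rewrite /gl_br comp_lfunDr comp_lfunDl opprD addrACA. Qed.

Lemma gl_brZr k x y : gl_br x (k *: y) = k *: gl_br x y.
Proof. by rewrite /gl_br -comp_lfunZl -comp_lfunZr scalerBr. Qed.

(** Taking adjoints reverses both products in the bracket, so it commutes with bracketing by a
    self-adjoint x. *)
Lemma gl_br_symm x y : x \in Lf f -> symm (gl_br x y) = gl_br x (symm y).
Proof.
rewrite mem_LfE => /eqP xE.
rewrite !symmE gl_brDr; congr (_ + _).
by rewrite !gl_brE linearD /= !adj_comp xE addrC.
Qed.

(** * Operators of rank one and their symmetrisations *)

Definition rank1 v w : 'End(V) := linfun (fun u => f u v *: w).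

Lemma rank1E v w u : rank1 v w u = f u v *: w.
Proof.
by rewrite linear_lfunE // => k u1 u2; rewrite formDl formZl scalerDl scalerA.
Qed.

Lemma adj_rank1 v w : adj (rank1 v w) = rank1 w v.
Proof. by apply: adjP => u t; rewrite !rank1E formZl formZr mulrC [f v t]formC. Qed.

Lemma rank1_bilinear : bilinear2 rank1.
Proof.
split=> [v k w1 w2 | w k v1 v2]; apply/lfunP => u.
  by rewrite lfunE /= lfunE /= !rank1E scalerDr !scalerA mulrC.
by rewrite lfunE /= lfunE /= !rank1E formDr formZr scalerDl scalerA.
Qed.

(** This is T(v,w) of the overview, whose S_a is [rank1 a a]. *)
Definition symT v w : 'End(V) := symm (rank1 v w).

Lemma symT_def v w : symT v w = rank1 v w + rank1 w v.
Proof. by rewrite /symT symmE adj_rank1. Qed.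

Lemma symTE v w u : symT v w u = f u v *: w + f u w *: v.
Proof. by rewrite symT_def lfunE /= !rank1E. Qed.

Lemma symTC v w : symT v w = symT w v.
Proof. by rewrite !symT_def addrC. Qed.

Lemma symT_bilinear : bilinear2 symT.
Proof.
have [linr linl] := rank1_bilinear.
by split=> [v k w1 w2 | w k v1 v2]; rewrite /symT ?linr ?linl linearP.
Qed.

Lemma symTDr v w1 w2 : symT v (w1 + w2) = symT v w1 + symT v w2.
Proof. by have [linr _] := symT_bilinear; rewrite -(scale1r w1) linr !scale1r. Qed.
Lemma symT0r v : symT v 0 = 0.
Proof. by apply: (addrI (symT v 0)); rewrite -symTDr !addr0. Qed.
Lemma symTZr k v w : symT v (k *: w) = k *: symT v w.
Proof.
by have [linr _] := symT_bilinear; have := linr v k w 0; rewrite !addr0 symT0r addr0.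
Qed.
Lemma symTDl v w1 w2 : symT (w1 + w2) v = symT w1 v + symT w2 v.
Proof. by rewrite !(symTC _ v) symTDr. Qed.
Lemma symTZl k v w : symT (k *: v) w = k *: symT v w.
Proof. by rewrite symTC symTZr symTC. Qed.
Lemma symT0l v : symT 0 v = 0.
Proof. by rewrite symTC symT0r. Qed.
Lemma symTvv v : symT v v = 0.
Proof. by rewrite symT_def addvv_char2. Qed.

Lemma symT_Lf v w : symT v w \in Lf f.
Proof. exact: symm_Lf. Qed.

Lemma gl_br_symT x v w : x \in Lf f ->
  gl_br x (symT v w) = symT (x v) w + symT v (x w).
Proof.
move=> xL; apply/lfunP => u; rewrite gl_br_app lfunE /= !symTE.
rewrite linearD !linearZ /= !(Lf_form _ _ xL) addrC -!addrA; congr (_ + _).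
by rewrite addrCA addrA [RHS]addrC.
Qed.

Lemma rank1_Lf v : rank1 v v \in Lf f.
Proof. by rewrite mem_LfE adj_rank1. Qed.

Lemma gl_br_rank1 a x : x \in Lf f -> gl_br (rank1 a a) x = symT a (x a).
Proof.
move=> xL; apply/lfunP => u; rewrite gl_br_app symTE !rank1E linearZ /= addrC.
by rewrite (Lf_form _ _ xL).
Qed.

(** The coordinate functionals of a basis are represented by f. Linear statements about phi thus
    reduce to the T(v,w). *)
Lemma rank1_sum x : exists s : seq (V * V), x = \sum_(p <- s) rank1 p.1 p.2.
Proof.
pose b := vbasis {:V}.
pose g (i : 'I_(\dim {:V})) := flat^-1%VF (linfun (coord b i : V -> F^o)).
exists [seq (g i, x b`_i) | i <- enum 'I_(\dim {:V})].
apply/lfunP => u; rewrite sum_lfunE big_map big_enum /=.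
rewrite [in LHS](coord_vbasis (memvf u)) linear_sum.
apply: eq_bigr => i _; rewrite linearZ rank1E; congr (_ *: _).
by rewrite /= formC -flatE flatVK lfunE.
Qed.

Lemma gl_tr_rank1 v w : gl_tr (rank1 v w) = f v w.
Proof.
rewrite /gl_tr /mxtrace [in RHS](coord_vbasis (memvf w)) linear_sumr /=.
apply: eq_bigr => i _; rewrite mxE rank1E linearZ /= formZr mulrC.
by rewrite [f v _]formC.
Qed.

Lemma gl_tr_gl_br x y : gl_tr (gl_br x y) = 0.
Proof.
have trC : gl_tr (x \o y)%VF = gl_tr (y \o x)%VF.
  pose b := vbasis {:V}.
  have mxM (p q : 'End(V)) : mx_of b (p \o q)%VF = mx_of b p *m mx_of b q.
    apply/matrixP => i j; rewrite !mxE comp_lfunE.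
    rewrite [q _ in LHS](coord_vbasis (memvf _)) !linear_sum.
    by apply: eq_bigr => l _; rewrite !linearZ /= !mxE mulrC.
  by rewrite /gl_tr !mxM mxtrace_mulC.
by rewrite gl_brE linearD /= trC addrr_pchar2.
Qed.

Lemma gl_br_sl x y : gl_br x y \in slv V.
Proof. by rewrite mem_slv gl_tr_gl_br. Qed.

(** * The derived series and its ideals *)

(** Amounts to containing L(f)^(2), by [symm_sl_isotropic] and [isotropic_Lf2]; every ideal argument
    aims at it. *)
Definition contains_isotropic (X : {vspace 'End(V)}) :=
  forall v w, f v w = 0 -> symT v w \in X.

Lemma line_sym v w : v != 0 -> v \in <[w]>%VS -> w \in <[v]>%VS.
Proof.
move=> v0 /vlineP[k vE]; apply/vlineP; exists k^-1.
by rewrite vE scalerK //; apply: contraNneq v0 => k0; rewrite vE k0 scale0r.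
Qed.

Lemma symT_line v w : v \in <[w]>%VS -> symT v w = 0.
Proof. by case/vlineP => k ->; rewrite symTZl symTvv scaler0. Qed.

(** Modulo X, T(a,b) depends on b only through f(a,b), since T(a,b) - T(a,c) = T(a,b-c); likewise
    for a. *)
Lemma symT_isotropic_mod X v w p q : contains_isotropic X -> f p q = 1 ->
  symT v w - f v w *: symT p q \in X.
Proof.
move=> isoX fpq.
have right a b c : f a b = f a c -> symT a b - symT a c \in X.
  move=> eq_f; rewrite -scaleN1r -symTZr -symTDr; apply: isoX.
  by rewrite formDr formZr eq_f mulN1r subrr.
have left a b c : f a c = f b c -> symT a c - symT b c \in X.
  by move=> eq_f; rewrite !(symTC _ c); apply: right; rewrite !(formC c).
have [fvw0|fvw0] := eqVneq (f v w) 0; first by rewrite fvw0 scale0r subr0 isoX.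
have v0 : v != 0 by apply: contraNneq fvw0 => ->; rewrite form0l.
have p0 : p != 0.
  by apply/eqP => p0; move: fpq; rewrite p0 form0l => /eqP; rewrite eq_sym oner_eq0.
have [/vlineP[k pE]|pv] := boolP (p \in <[v]>%VS).
  rewrite pE symTZl -symTZr -symTZr; apply: right.
  by rewrite !formZr -formZl -pE fpq mulr1.
have vp : v \notin <[p]>%VS by apply: contra pv; apply: line_sym.
have [c cp fvc] := form_separates vp; have [d dv fpd] := form_separates pv.
have {}cp : f p c = 0 by apply/cp/memv_line.
have {}dv : f v d = 0 by apply/dv/memv_line.
(* The common partner u satisfies f(v,u) = f(v,w) and f(p,u) = 1, so T(v,w), T(v,u), T(f(v,w) p, u)
   and f(v,w) T(p,q) all agree modulo X. *)
pose u := f v w *: c + d.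
have fvu : f v u = f v w by rewrite formDr formZr fvc dv mulr1 addr0.
have fpu : f p u = 1 by rewrite formDr formZr cp fpd mulr0 add0r.
rewrite -(subrK (symT v u) (symT v w)) -addrA rpredD ?right //.
rewrite -(subrK (symT (f v w *: p) u) (symT v u)) -addrA rpredD ?left //.
  by rewrite fvu formZl fpu mulr1.
by rewrite symTZl -!symTZr right // !formZr fpu fpq.
Qed.

Lemma symm_isotropic_mod X z p q : contains_isotropic X -> f p q = 1 ->
  symm z - gl_tr z *: symT p q \in X.
Proof.
move=> isoX fpq; have [s ->] := rank1_sum z.
rewrite !linear_sum scaler_suml -sumrB; apply: rpred_sum => -[v w] _ /=.
by rewrite gl_tr_rank1; apply: symT_isotropic_mod.
Qed.

(** [vpick] is zero only on the zero space, so this settles the degenerate case. *)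
Lemma endo_eq0 z : vpick {:V} = 0 -> z = 0.
Proof.
move/eqP; rewrite vpick0 => /eqP V0; apply/lfunP => u.
have /eqP -> : u == 0 by rewrite -memv0 -V0 memvf.
by rewrite !linear0.
Qed.

Lemma symm_sl_isotropic X : contains_isotropic X -> (symm @: slv V <= X)%VS.
Proof.
move=> isoX; apply/subvP => _ /memv_imgP[z zsl ->].
pose v := vpick {:V}; have [v0|v0] := eqVneq v 0.
  by rewrite (endo_eq0 z v0) linear0 mem0v.
have [|c _ fvc] := @form_separates 0%VS v; first by rewrite memv0.
have := symm_isotropic_mod z isoX fvc.
by move: zsl; rewrite mem_slv => /eqP ->; rewrite scale0r subr0.
Qed.

Lemma Lf1_br x y : x \in Lf f -> y \in Lf f -> gl_br x y \in Lf1 f.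
Proof.
have [gl_bil _ _] := gl_lie V => xL yL.
exact: (brv_sub (Lf f) (Lf f) (Lf1 f) gl_bil).2 (subvv _) x y xL yL.
Qed.

Lemma symT_Lf1 v w : symT v w \in Lf1 f.
Proof.
(* [S_a, S_(a+b)] = f(a,b) T(a,b). *)
have nonorth a b : f a b != 0 -> symT a b \in Lf1 f.
  move=> fab; have := Lf1_br (rank1_Lf a) (rank1_Lf (a + b)).
  rewrite gl_br_rank1 ?rank1_Lf // rank1E symTZr symTDr symTvv formDr f_alt !add0r.
  by rewrite rpredZeq (negPf fab).
have [fvw0|] := eqVneq (f v w) 0; last exact: nonorth.
have [->|v0] := eqVneq v 0; first by rewrite symT0l mem0v.
have [|c _ fvc] := @form_separates 0%VS v; first by rewrite memv0.
(* An orthogonal pair is reached as T(v,w+c) - T(v,c), both non-orthogonal. *)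
rewrite -(addrK (symT v c) (symT v w)) -symTDr rpredB ?nonorth //.
  by rewrite formDr fvw0 fvc add0r oner_neq0.
by rewrite fvc oner_neq0.
Qed.

Lemma Lf1_symm : Lf1 f = limg symm.
Proof.
have [gl_bil _ _] := gl_lie V.
apply/eqP; rewrite eqEsubv; apply/andP; split.
  apply/brv_sub => // x y; rewrite !mem_LfE => /eqP xE /eqP yE.
  (* For self-adjoint x and y, the product yx is the adjoint of xy. *)
  have -> : gl_br x y = symm (x \o y)%VF by rewrite symmE adj_comp xE yE gl_brE.
  exact/memv_img/memvf.
apply/subvP => _ /memv_imgP[z _ ->]; have [s ->] := rank1_sum z.
by rewrite linear_sum rpred_sum // => -[v w] _; apply: symT_Lf1.
Qed.

Lemma Lf1_sub : (Lf1 f <= Lf f)%VS.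
Proof. by rewrite Lf1_symm; apply/subvP => _ /memv_imgP[z _ ->]; apply: symm_Lf. Qed.

Lemma isotropic_Lf2 : contains_isotropic (Lf2 f).
Proof.
have [gl_bil _ _] := gl_lie V => v w fvw.
have [/symT_line -> | vw] := boolP (v \in <[w]>%VS); first exact: mem0v.
have [c wc fvc] := form_separates vw.
have {}wc : f w c = 0 by apply/wc/memv_line.
(* T(c,v) fixes v and kills w, hence it fixes T(v,w) under the bracket. *)
suff <- : gl_br (symT c v) (symT v w) = symT v w.
  exact: (brv_sub (Lf1 f) (Lf1 f) (Lf2 f) gl_bil).2 (subvv _) _ _ (symT_Lf1 _ _)
    (symT_Lf1 _ _).
rewrite gl_br_symT ?symT_Lf // !symTE f_alt scale0r addr0 fvc scale1r.
by rewrite wc formC fvw !scale0r addr0 symT0r addr0.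
Qed.

(** One inclusion holds because [x, phi(z)] = phi([x,z]) and commutators are traceless; the other
    because the isotropic T(v,w) span phi(sl). *)
Lemma Lf2_symm : Lf2 f = (symm @: slv V)%VS.
Proof.
have [gl_bil _ _] := gl_lie V.
apply/eqP; rewrite eqEsubv symm_sl_isotropic ?andbT; last exact: isotropic_Lf2.
apply/brv_sub => // x y /(subvP Lf1_sub) xL; rewrite Lf1_symm => /memv_imgP[z _ ->].
by rewrite -gl_br_symm // memv_img // gl_br_sl.
Qed.

Lemma Lf2_sub_Lf1 : (Lf2 f <= Lf1 f)%VS.
Proof. by rewrite Lf2_symm Lf1_symm limgS // subvf. Qed.

Lemma Lf2_sub : (Lf2 f <= Lf f)%VS.
Proof. exact: subv_trans Lf2_sub_Lf1 Lf1_sub. Qed.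

(** Letting x range over all of L(f) makes L(f)^(1) / L(f)^(2) a trivial module. *)
Lemma Lf2_br x y : x \in Lf f -> y \in Lf1 f -> gl_br x y \in Lf2 f.
Proof.
rewrite Lf1_symm Lf2_symm => xL /memv_imgP[z _ ->].
by rewrite -gl_br_symm // memv_img // gl_br_sl.
Qed.

Lemma Lf1_alternating x v : x \in Lf1 f -> f (x v) v = 0.
Proof.
rewrite Lf1_symm => /memv_imgP[z _ ->].
by rewrite symmE lfunE /= formDl form_adj [f v _]formC addrr_pchar2.
Qed.

(** * Vectors orthogonal to a list and outside given subspaces *)

Fixpoint perp (s : seq V) : {vspace V} :=
  if s is b :: s' then (lker (flat b) :&: perp s')%VS else fullv.

Lemma perp_dim s : (\dim {:V} <= \dim (perp s) + size s)%N.
Proof.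
elim: s => [|b s IHs] /=; first by rewrite addn0.
apply: leq_trans IHs _; rewrite addnS -addSn leq_add2r.
rewrite -(leq_add2l (\dim {:V})).
have dim_b : (\dim {:V} <= (\dim (lker (flat b))).+1)%N.
  rewrite -(limg_ker_dim (flat b) fullv) capfv -addn1 leq_add2l.
  by rewrite (leq_trans (dimvS (subvf _))) // dimvf.
rewrite addnS -addSn; apply: leq_trans (leq_add dim_b (leqnn _)) _.
rewrite addSn -dimv_sum_cap -addSn leq_add2r ltnS dimvS ?subvf //.
Qed.

Lemma mem_perp s u : u \in perp s -> {in s, forall b, f u b = 0}.
Proof.
elim: s => //= b s IHs /memv_capP[]; rewrite memv_ker => /eqP ub us c.
rewrite inE => /predU1P[->|/(IHs us)//].
by rewrite formC -flatE ub.
Qed.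

Lemma perp_escape s (W : {vspace V}) : (size s + \dim W < \dim {:V})%N ->
  exists2 e, e \notin W & {in s, forall b, f e b = 0}.
Proof.
move=> ltW; have /subvPn[e ePerp eW] : ~~ (perp s <= W)%VS.
  apply: contraL ltW => /dimvS leW; rewrite -leqNgt addnC.
  by apply: leq_trans (perp_dim s) _; rewrite leq_add2r.
by exists e => //; apply: mem_perp.
Qed.

(** A space is never the union of two proper subspaces, even over the field with two elements, where
    three may suffice to cover it. *)
Lemma perp_escape2 s (W1 W2 : {vspace V}) :
    (size s + \dim W1 < \dim {:V})%N -> (size s + \dim W2 < \dim {:V})%N ->
  exists e, [/\ e \notin W1, e \notin W2 & {in s, forall b, f e b = 0}].
Proof.
move=> /perp_escape[e1 e1W1 e1s] /perp_escape[e2 e2W2 e2s].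
have [e1W2|] := boolP (e1 \in W2); last by exists e1.
have [e2W1|] := boolP (e2 \in W1); last by exists e2.
exists (e1 + e2); split=> [||b bs]; last by rewrite formDl e1s ?e2s ?addr0.
  by rewrite rpredDr.
by rewrite rpredDl.
Qed.

Lemma nonscalar_witness y : y \notin scalv V -> exists a, y a \notin <[a]>%VS.
Proof.
move=> y_nonscal; pose v := vpick {:V}; have [v0|v0] := eqVneq v 0.
  by case/negP: y_nonscal; rewrite (endo_eq0 y v0) mem0v.
have [/vlineP[k yv]|yv] := boolP (y v \in <[v]>%VS); last by exists v.
have /lfunPn[w yw] : y != k *: \1%VF.
  by apply: contraNneq y_nonscal => ->; rewrite rpredZ ?memv_line.
rewrite scale_lfunE id_lfunE in yw.
have [/vlineP[k1 yw1]|] := boolP (y w \in <[w]>%VS); last by exists w.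
have k1k : k - k1 != 0.
  by rewrite subr_eq0; apply: contraNneq yw => ->; rewrite yw1.
(* v and w are eigenvectors for the distinct eigenvalues k and k1, so their sum is no
   eigenvector. *)
exists (v + w); apply/negP => /vlineP[k2].
rewrite linearD /= yv yw1 scalerDr => yvw.
have [k2k|k2k] := eqVneq k1 k2.
  move/eqP: yvw; rewrite k2k => /eqP/addIr/eqP; rewrite -subr_eq0 -scalerBl.
  by rewrite scaler_eq0 (negPf v0) -k2k (negPf k1k).
have vw : w = ((k1 - k2)^-1 * (k2 - k)) *: v.
  have k12 : k1 - k2 != 0 by rewrite subr_eq0.
  apply: (scalerI k12); rewrite scalerA mulrA mulfV // mul1r !scalerBl.
  by apply/eqP; rewrite subr_eq addrAC -yvw [k *: v + _]addrC addrK.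
by case/negP: yw; rewrite vw linearZ /= yv !scalerA mulrC.
Qed.

(** Replacing one entry of an isotropic T at a time. Submodules and ideals both satisfy this, but by
    different brackets. *)
Definition moves_isotropic (X : {vspace 'End(V)}) := forall a b c,
  a \notin <[b]>%VS -> b != 0 -> f a b = 0 -> f c b = 0 ->
  symT a b \in X -> symT c b \in X.

Lemma moves_isotropic_all X a b : (4 <= \dim {:V})%N -> moves_isotropic X ->
    a \notin <[b]>%VS -> b != 0 -> f a b = 0 -> symT a b \in X ->
  contains_isotropic X.
Proof.
move=> dimV mvX ab b0 fab Tab p q fpq.
have [->|q0] := eqVneq q 0; first by rewrite symT0r mem0v.
have lt_dim d : (size [:: b; q] + \dim <[d]> < \dim {:V})%N.
  by apply: leq_trans dimV; rewrite dim_vline; case: eqP.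
(* The route is T(a,b), T(e,b), T(q,e), T(p,q), with e orthogonal to b and q and on neither line;
   this is where dimension 4 enters, as 2 + 1 < 4. *)
have [e [eb eq es]] := perp_escape2 (lt_dim b) (lt_dim q).
have feb : f e b = 0 by apply: es; rewrite inE eqxx.
have feq : f e q = 0 by apply: es; rewrite !inE eqxx orbT.
apply: (mvX e) => //; rewrite symTC; apply: (mvX b) => //.
- by apply: contra eb; apply: line_sym.
- by apply: contraNneq eq => ->; rewrite mem0v.
- by rewrite formC.
- by rewrite formC.
by rewrite symTC; apply: (mvX a).
Qed.

Lemma isotropic_submodule (X : {vspace 'End(V)}) y : (4 <= \dim {:V})%N ->
    (forall x, x \in Lf f -> {in X, forall z, gl_br x z \in X}) ->
    (X <= Lf1 f)%VS -> y \in X -> y \notin scalv V ->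
  contains_isotropic X.
Proof.
move=> dimV stX sX yX y_nonscal.
have [a aya] := nonscalar_witness y_nonscal.
have yL1 := subvP sX _ yX; have yL := subvP Lf1_sub _ yL1.
have a0 : a != 0 by apply: contraNneq aya => ->; rewrite linear0 mem0v.
apply: (@moves_isotropic_all X (y a) a) => //; last first.
- by rewrite symTC -gl_br_rank1 // stX // rank1_Lf.
- exact: Lf1_alternating.
move=> {a aya a0} a b c ab b0 fab fcb Tab.
(* [S_d, T(a',b)] = f(d,a') T(d,b) when d is orthogonal to b. *)
have move1 a' d : f a' b = 0 -> f d b = 0 -> f d a' != 0 -> symT a' b \in X ->
    symT d b \in X.
  move=> fab' fdb fda Tab'; have := stX _ (rank1_Lf d) _ Tab'.
  rewrite gl_br_rank1 ?symT_Lf // symTE fdb scale0r addr0 symTZr.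
  by rewrite rpredZeq (negPf fda).
have [cb|cb] := boolP (c \in <[b]>%VS); first by rewrite symT_line ?mem0v.
suff [d [fdb fda fdc]] : exists d, [/\ f d b = 0, f d a != 0 & f d c != 0].
  apply: (move1 d) => //; first by rewrite formC.
  exact: (move1 a).
(* f(c,a) may vanish, so the move passes through some d orthogonal to b but to neither a nor c: one
   of d1, d2, d1 + d2. *)
have [d1 bd1 ad1] := form_separates ab; have [d2 bd2 cd2] := form_separates cb.
have {}bd1 : f d1 b = 0 by rewrite formC bd1 // memv_line.
have {}bd2 : f d2 b = 0 by rewrite formC bd2 // memv_line.
have [cd1|cd1] := eqVneq (f d1 c) 0; last first.
  by exists d1; rewrite bd1 cd1 formC ad1 oner_neq0.
have [ad2|ad2] := eqVneq (f d2 a) 0; last first.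
  by exists d2; rewrite bd2 ad2 (formC d2 c) cd2 oner_neq0.
exists (d1 + d2); rewrite !formDl bd1 bd2 cd1 ad2 (formC d1) (formC d2) ad1 cd2.
by rewrite !addr0 add0r oner_neq0.
Qed.

(** The S_d do not lie in L(f)^(2), so only brackets with isotropic T's are available, at the price
    of more room in V. *)
Lemma isotropic_ideal (X : {vspace 'End(V)}) y : (6 <= \dim {:V})%N ->
    (forall x, x \in Lf2 f -> {in X, forall z, gl_br x z \in X}) ->
    (X <= Lf1 f)%VS -> y \in X -> y \notin scalv V ->
  contains_isotropic X.
Proof.
move=> dimV stX sX yX y_nonscal.
have [a aya] := nonscalar_witness y_nonscal.
have yL1 := subvP sX _ yX; have yL := subvP Lf1_sub _ yL1.
have a0 : a != 0 by apply: contraNneq aya => ->; rewrite linear0 mem0v.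
have fyaa : f (y a) a = 0 by apply: Lf1_alternating.
have dim_le2 c d : (\dim (<[c]> + <[d]>) <= 2)%N.
  apply: leq_trans (dimv_add_leqif _ _) _.
  by rewrite !dim_vline (leq_add (leq_b1 _) (leq_b1 _)).
(* Two conditions and a span of dimension at most 2 to avoid: this fits as 2 + 2 < 6. *)
have [b bW bs] : exists2 b, b \notin (<[a]> + <[y a]>)%VS &
    {in [:: a; y a], forall c, f b c = 0}.
  apply: perp_escape; apply: leq_trans dimV.
  exact: leq_ltn_trans (leq_add (leqnn 2) (dim_le2 _ _)) _.
have fba : f b a = 0 by apply: bs; rewrite inE eqxx.
have fbya : f b (y a) = 0 by apply: bs; rewrite !inE eqxx orbT.
have ba : b \notin <[a]>%VS.
  by apply: contra bW => ba; rewrite (subvP (addvSl _ _)).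
have yaW : y a \notin (<[a]> + <[b]>)%VS.
  apply/negP => /memv_addP[_ /vlineP[k ->] [_ /vlineP[l ->] yaE]].
  have [l0|l0] := eqVneq l 0.
    by case/negP: aya; rewrite yaE l0 scale0r addr0 memvZ ?memv_line.
  case/negP: bW; rewrite -(scalerK l0 b) rpredZ //.
  rewrite -(addKr (k *: a) (l *: b)) -yaE -scaleNr.
  by rewrite memv_add ?rpredZ ?memv_line.
have [c cW fyac] := form_separates yaW.
have fac : f a c = 0 by apply: cW; rewrite (subvP (addvSl _ _)) ?memv_line.
have fbc : f b c = 0 by apply: cW; rewrite (subvP (addvSr _ _)) ?memv_line.
apply: (moves_isotropic_all (leq_trans _ dimV) _ ba a0 fba) => //; last first.
- (* For a, b, c pairwise orthogonal the double bracket is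
     [symT a (f (y a) c *: b + f (y a) b *: c)]. *)
  have -> : symT b a = gl_br (symT c a) (gl_br (symT a b) y).
    rewrite (gl_brC _ y) gl_br_symT // gl_brDr !gl_br_symT ?symT_Lf // !symTE.
    rewrite fac f_alt fbc fba fyac fyaa !scale0r scale1r !addr0.
    rewrite symT0l symT0r addr0 add0r (Lf_form b a yL) fbya scale0r addr0.
    by rewrite symTZr symTvv scaler0 addr0 symTC.
  by rewrite !stX // isotropic_Lf2 // formC.
move=> {a aya a0 fyaa b bW bs fba fbya ba yaW c cW fyac fac fbc} a b d ab b0 fab fdb Tab.
(* With c orthogonal to b and d' and f(a',c) = 1, T(c,d') sends a' to d' and kills b. No such c
   exists only when a' lies in the span of b and d', and then T(a',b) is a multiple of T(d',b). *)
have move1 a' d' : a' \notin <[b]>%VS -> f a' b = 0 -> f d' b = 0 -> f d' a' = 0 ->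
    symT a' b \in X -> symT d' b \in X.
  move=> ab' fab' fdb' fda Tab'.
  have [|/form_separates[c cW fac]] := boolP (a' \in (<[b]> + <[d']>)%VS).
    case/memv_addP => _ /vlineP[k ->] [_ /vlineP[l ->] aE].
    have l0 : l != 0.
      apply: contraNneq ab' => l0.
      by rewrite aE l0 scale0r addr0 rpredZ ?memv_line.
    move: Tab'; rewrite aE symTDl !symTZl symTvv scaler0 add0r.
    by rewrite rpredZeq (negPf l0).
  have fbc : f b c = 0 by apply: cW; rewrite (subvP (addvSl _ _)) ?memv_line.
  have fdc : f d' c = 0 by apply: cW; rewrite (subvP (addvSr _ _)) ?memv_line.
  have -> : symT d' b = gl_br (symT c d') (symT a' b).
    rewrite gl_br_symT ?symT_Lf // !symTE fac scale1r (formC a') fda fbc.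
    by rewrite (formC b) fdb' !scale0r !addr0 symT0r addr0.
  by rewrite stX // isotropic_Lf2 // formC.
(* The detour through e removes the condition f(d,a) = 0. *)
have [|e eb es] := @perp_escape [:: a; b; d] <[b]>%VS.
  by apply: leq_trans dimV; rewrite dim_vline; case: eqP.
have [fea feb fed] : [/\ f e a = 0, f e b = 0 & f e d = 0].
  by split; apply: es; rewrite !inE eqxx ?orbT.
apply: (move1 e) => //; first by rewrite formC.
exact: (move1 a).
Qed.

(** * Symplectic bases and matrices *)

(** The families are indexed by all naturals so that they can be extended by a test on the index;
    values from k on are arbitrary. *)
Lemma symplectic_family (k : nat) : (2 * k <= \dim {:V})%N ->
  exists p q : nat -> V, forall i j, (i < k)%N -> (j < k)%N ->
    [/\ f (p i) (p j) = 0, f (q i) (q j) = 0 & f (p i) (q j) = (i == j)%:R].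
Proof.
elim: k => [|k IHk] dimV; first by exists (fun=> 0), (fun=> 0).
have [p [q pqE]] := IHk (leq_trans (leq_mul (leqnn 2) (leqnSn k)) dimV).
pose W := (<<mkseq p k>> + <<mkseq q k>>)%VS.
have pW i : (i < k)%N -> p i \in W.
  by move=> ik; apply: (subvP (addvSl _ _)); rewrite memv_span // map_f // mem_iota.
have qW i : (i < k)%N -> q i \in W.
  by move=> ik; apply: (subvP (addvSr _ _)); rewrite memv_span // map_f // mem_iota.
have /subvPn[v _ vW] : ~~ (fullv <= W)%VS.
  apply: contraL dimV => /dimvS leW; rewrite -ltnNge; apply: leq_ltn_trans leW _.
  apply: leq_ltn_trans (dimv_add_leqif _ _) _.
  apply: leq_ltn_trans (leq_add (dim_span _) (dim_span _)) _.
  by rewrite !size_mkseq addnn mul2n ltn_double.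
(* Symplectic Gram-Schmidt: v' is orthogonal to the pairs already built and still outside their span
   W, so a partner w orthogonal to W exists. *)
pose v' := v + \sum_(i < k) (f v (q i) *: p i + f v (p i) *: q i).
have v'W : v' \notin W.
  rewrite rpredDr // rpred_sum // => i _.
  by rewrite rpredD // rpredZ ?pW ?qW.
have v'p j : (j < k)%N -> f v' (p j) = 0.
  move=> jk; rewrite formDl linear_sumlz (bigD1 (Ordinal jk)) //= big1 => [|i ij].
    have [_ _ pq] := pqE j j jk jk; rewrite formDl !formZl f_alt (formC (q j)) pq.
    by rewrite eqxx mulr0 mulr1 add0r addr0 addrr_pchar2.
  have [pp _ _] := pqE i j (ltn_ord i) jk; have [_ _ pq] := pqE j i jk (ltn_ord i).
  have /negPf ji : j != i by apply: contraNneq ij => ji; apply/eqP/val_inj.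
  by rewrite formDl !formZl pp (formC (q i)) pq ji !mulr0 addr0.
have v'q j : (j < k)%N -> f v' (q j) = 0.
  move=> jk; rewrite formDl linear_sumlz (bigD1 (Ordinal jk)) //= big1 => [|i ij].
    have [_ _ pq] := pqE j j jk jk; rewrite formDl !formZl f_alt pq.
    by rewrite eqxx mulr0 mulr1 !addr0 addrr_pchar2.
  have [_ qq pq] := pqE i j (ltn_ord i) jk.
  have /negPf ij' : (i : nat) != j by apply: contraNneq ij => ij; apply/eqP/val_inj.
  by rewrite formDl !formZl qq pq ij' !mulr0 addr0.
have [w wW fvw] := form_separates v'W.
exists (fun i => if i == k then v' else p i), (fun i => if i == k then w else q i).
move=> i j; rewrite (ltnS i) (ltnS j) (leq_eqVlt i) (leq_eqVlt j).
case: (eqVneq i k) => [-> _|ik /= ltik]; case: (eqVneq j k) => [-> _|jk /= ltjk].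
- by rewrite !f_alt fvw.
- by rewrite v'p ?v'q // formC wW ?qW.
- by rewrite (negPf ik) formC v'p // !wW ?pW ?qW.
- by have [-> -> ->] := pqE i j ltik ltjk.
Qed.

Section SymplecticBasis.
Variables (n : nat) (p q : 'I_n -> V).
Hypothesis dimV : \dim {:V} = (n + n)%N.
Hypothesis fpp : forall i j, f (p i) (p j) = 0.
Hypothesis fqq : forall i j, f (q i) (q j) = 0.
Hypothesis fpq : forall i j, f (p i) (q j) = (i == j)%:R.

Definition sbasis : (n + n).-tuple V :=
  [tuple match split i with inl i => p i | inr i => q i end | i < n + n].
Definition sdual (i : 'I_(n + n)) : V :=
  match split i with inl i => q i | inr i => p i end.
Local Notation e := sbasis.

Lemma sbasis_l i : e`_(lshift n i) = p i.
Proof.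
by rewrite -tnth_nth tnth_mktuple; have := unsplitK (inl i : 'I_n + 'I_n) => /= ->.
Qed.
Lemma sbasis_r i : e`_(rshift n i) = q i.
Proof.
by rewrite -tnth_nth tnth_mktuple; have := unsplitK (inr i : 'I_n + 'I_n) => /= ->.
Qed.
Lemma sdual_l i : sdual (lshift n i) = q i.
Proof. by rewrite /sdual; have := unsplitK (inl i : 'I_n + 'I_n) => /= ->. Qed.
Lemma sdual_r i : sdual (rshift n i) = p i.
Proof. by rewrite /sdual; have := unsplitK (inr i : 'I_n + 'I_n) => /= ->. Qed.

Lemma fqp i j : f (q i) (p j) = (i == j)%:R.
Proof. by rewrite formC fpq eq_sym. Qed.

Lemma form_sdual (i j : 'I_(n + n)) : f e`_i (sdual j) = (i == j)%:R.
Proof.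
rewrite -[i]splitK -[j]splitK.
case: (split i) => {}i; case: (split j) => {}j /=;
  rewrite ?sbasis_l ?sbasis_r ?sdual_l ?sdual_r ?fpp ?fqq ?fpq ?fqp.
- by rewrite (inj_eq (@lshift_inj _ _)).
- by rewrite eq_lrshift.
- by rewrite eq_rlshift.
- by rewrite (inj_eq (@rshift_inj _ _)).
Qed.

Lemma sbasis_basis : basis_of {:V} e.
Proof.
rewrite basisEfree subvf dimV size_tuple leqnn !andbT.
apply/freeP => k k0 i; have := congr1 (f^~ (sdual i)) k0.
rewrite linear_sumlz /= form0l (bigD1 i) //= big1 => [|j ji].
  by rewrite formZl form_sdual eqxx mulr1 addr0.
by rewrite formZl form_sdual (negPf ji) mulr0.
Qed.

Lemma coord_sbasis i v : coord e i v = f v (sdual i).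
Proof.
rewrite [in RHS](coord_basis sbasis_basis (memvf v)) linear_sumlz /= (bigD1 i) //=.
rewrite big1 => [|j ji]; first by rewrite formZl form_sdual eqxx mulr1 addr0.
by rewrite formZl form_sdual (negPf ji) mulr0.
Qed.

Lemma sbasis_sum v : v = \sum_i f v (sdual i) *: e`_i.
Proof.
rewrite {1}(coord_basis sbasis_basis (memvf v)).
by apply: eq_bigr => i _; rewrite coord_sbasis.
Qed.

Lemma symplectic_sum v : v = \sum_i (f v (q i) *: p i + f v (p i) *: q i).
Proof.
rewrite {1}(sbasis_sum v) big_split_ord big_split /=.
congr (_ + _); apply: eq_bigr => i _; first by rewrite sdual_l sbasis_l.
by rewrite sdual_r sbasis_r.
Qed.

Lemma form_sum u v : f u v = \sum_i (f u (q i) * f v (p i) + f u (p i) * f v (q i)).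
Proof.
rewrite {1}(symplectic_sum u) linear_sumlz; apply: eq_bigr => i _ /=.
by rewrite formDl !formZl (formC (p i)) (formC (q i)).
Qed.

Lemma sdual_sum v : v = \sum_(i < n + n) f v e`_i *: sdual i.
Proof.
rewrite {1}(symplectic_sum v) big_split_ord big_split /= addrC.
congr (_ + _); apply: eq_bigr => i _; first by rewrite sdual_l sbasis_l.
by rewrite sdual_r sbasis_r.
Qed.

Lemma mx_of_form x i j : mx_of e x i j = f (x e`_j) (sdual i).
Proof. by rewrite mxE coord_sbasis. Qed.

Lemma mx_of_inj : injective (mx_of e).
Proof.
move=> x y eq_xy; have eq_e (i : 'I_(n + n)) : x e`_i = y e`_i.
  rewrite (sbasis_sum (x e`_i)) (sbasis_sum (y e`_i)); apply: eq_bigr => j _.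
  by rewrite -!mx_of_form eq_xy.
apply/lfunP => v; rewrite (sbasis_sum v) !linear_sum.
by apply: eq_bigr => i _; rewrite !linearZ /= eq_e.
Qed.

Lemma mx_of_onto X : exists x, mx_of e x = X.
Proof.
pose g v := \sum_i (\sum_j X i j * f v (sdual j)) *: e`_i.
have g_lin : linear g.
  move=> k u v; rewrite /g scaler_sumr -big_split; apply: eq_bigr => i _ /=.
  rewrite scalerA -scalerDl mulr_sumr -big_split; congr (_ *: _).
  by apply: eq_bigr => j _ /=; rewrite formDl formZl mulrDr mulrCA.
have g_e (j : 'I_(n + n)) : g e`_j = \sum_i X i j *: e`_i.
  apply: eq_bigr => i _; congr (_ *: _); rewrite (bigD1 j) //= big1 => [|j' jj'].
    by rewrite form_sdual eqxx mulr1 addr0.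
  by rewrite form_sdual eq_sym (negPf jj') mulr0.
exists (linfun g); apply/matrixP => i j; rewrite mx_of_form linear_lfunE // g_e.
rewrite linear_sumlz (bigD1 i) //= big1 => [|i' ii']; rewrite formZl form_sdual.
  by rewrite eqxx mulr1 addr0.
by rewrite (negPf ii') mulr0.
Qed.

Lemma mx_ofD x y : mx_of e (x + y) = mx_of e x + mx_of e y.
Proof. by apply/matrixP => i j; rewrite !mxE lfunE /= linearD. Qed.

Lemma mx_of_id : mx_of e \1%VF = 1%:M.
Proof.
apply/matrixP => i j; rewrite mx_of_form id_lfunE form_sdual mxE.
by rewrite eq_sym.
Qed.

(** Transposition conjugated by the Gram matrix of f, which swaps the two halves of the basis; the
    usual signs disappear. *)
Lemma mx_of_adj x A B C D : mx_of e x = block_mx A B C D ->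
  mx_of e (adj x) = block_mx D^T B^T C^T A^T.
Proof.
move=> xE; have entry (i j : 'I_(n + n)) : f (x e`_j) (sdual i) = block_mx A B C D i j.
  by rewrite -mx_of_form xE.
apply/matrixP => i j; rewrite mx_of_form form_adj formC.
rewrite -[i]splitK -[j]splitK; case: (split i) => {}i; case: (split j) => {}j /=.
- rewrite block_mxEul mxE -(block_mxEdr A B C) -entry.
  by rewrite sdual_l sbasis_l sdual_r sbasis_r.
- by rewrite block_mxEur mxE -(block_mxEur A B C D) -entry !sdual_l !sbasis_r.
- by rewrite block_mxEdl mxE -(block_mxEdl A B C D) -entry !sdual_r !sbasis_l.
- rewrite block_mxEdr mxE -(block_mxEul A B C D) -entry.
  by rewrite sdual_l sbasis_l sdual_r sbasis_r.
Qed.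

Lemma mx_of_symm z A B C D : mx_of e z = block_mx A B C D ->
  mx_of e (symm z) = block_mx (A + D^T) (B + B^T) (C + C^T) (A + D^T)^T.
Proof.
move=> zE; rewrite symmE mx_ofD (mx_of_adj zE) zE add_block_mx.
by rewrite linearD /= trmxK [A^T + D]addrC.
Qed.

Lemma Lf_mx x : x \in Lf f <-> exists A B C : 'M[F]_n,
  [/\ mx_of e x = block_mx A B C A^T, B^T = B & C^T = C].
Proof.
rewrite mem_LfE; split=> [/eqP xE | [A [B [C [xE BE CE]]]]].
  have xB := esym (submxK (mx_of e x : 'M_(n + n, n + n))).
  have := mx_of_adj xB; rewrite xE {1}xB => /eq_block_mx[ulE urE dlE drE].
  by exists (ulsubmx (mx_of e x)), (ursubmx (mx_of e x)), (dlsubmx (mx_of e x));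
    split; [rewrite {1}xB drE ulE trmxK | |].
by apply/eqP/mx_of_inj; rewrite (mx_of_adj xE) trmxK BE CE.
Qed.

(** On a matrix of L(f), with diagonal blocks A and A', the full trace is 2 tr A = 0; tr A is the
    finer invariant. *)
Definition half_tr x : F^o := \sum_i f (x (p i)) (q i).

Lemma half_tr_linear : linear half_tr.
Proof.
move=> k x y; rewrite /half_tr scaler_sumr -big_split; apply: eq_bigr => i _ /=.
by rewrite add_lfunE scale_lfunE formDl formZl.
Qed.
HB.instance Definition _ := GRing.isSemilinear.Build F 'End(V) F^o _
  half_tr (GRing.semilinear_linear half_tr_linear).

(** The adjoint carries the diagonal entries of the second half of the basis to the first half. So
    the trace factors through phi. *)
Lemma half_tr_symm z : half_tr (symm z) = gl_tr z.
Proof.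
rewrite (gl_trE z sbasis_basis) /mxtrace big_split_ord /=.
transitivity (\sum_i (f (z (p i)) (q i) + f (z (q i)) (p i))).
  apply: eq_bigr => i _; rewrite symmE lfunE /= formDl form_adj.
  by rewrite (formC (p i)).
rewrite big_split; congr (_ + _); apply: eq_bigr => i _.
  by rewrite mx_of_form sbasis_l sdual_l.
by rewrite mx_of_form sbasis_r sdual_r.
Qed.

Lemma Lf_sl : (Lf f <= slv V)%VS.
Proof.
apply/subvP => x; rewrite -symm_eq0 mem_slv -half_tr_symm => /eqP ->.
by rewrite linear0.
Qed.

Lemma Lf2E x : (x \in Lf2 f) = (x \in Lf1 f) && (half_tr x == 0).
Proof.
rewrite Lf2_symm Lf1_symm; apply/memv_imgP/andP => [[z zsl ->]|].
  by rewrite half_tr_symm -mem_slv zsl memv_img ?memvf.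
case=> /memv_imgP[z _ ->]; rewrite half_tr_symm -mem_slv.
by exists z.
Qed.

Lemma half_tr_mx x A B C D : mx_of e x = block_mx A B C D -> half_tr x = \tr A.
Proof.
move=> xE; apply: eq_bigr => i _.
by rewrite -(block_mxEul A B C D) -xE mx_of_form sbasis_l sdual_l.
Qed.

Lemma alternating_mx_symm (B : 'M[F]_n) : alternating_mx (B + B^T).
Proof.
split=> [i j|i]; rewrite !mxE; last exact: addrr_pchar2.
by rewrite oppr_pchar2 // addrC.
Qed.

Lemma alternating_mxP (B : 'M[F]_n) : alternating_mx B ->
  exists Q : 'M[F]_n, B = Q + Q^T.
Proof.
move=> [Balt B0]; exists (\matrix_(i, j) if (i < j)%N then B i j else 0).
apply/matrixP => i j; rewrite !mxE.
case: ltngtP => [_|_|/val_inj ->]; rewrite ?addr0 ?add0r ?B0 //.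
by rewrite Balt oppr_pchar2.
Qed.

Lemma Lf1_mx x : x \in Lf1 f <-> exists A B C : 'M[F]_n,
  [/\ mx_of e x = block_mx A B C A^T, alternating_mx B & alternating_mx C].
Proof.
rewrite Lf1_symm; split=> [/memv_imgP[z _ ->] | [A [B [C [xE Balt Calt]]]]].
  have := mx_of_symm (esym (submxK (mx_of e z : 'M_(n + n, n + n)))).
  set A := _ + _; set B := _ + _; set C := _ + _ => zE.
  by exists A, B, C; split; rewrite // /B /C; apply: alternating_mx_symm.
have [[B' BE] [C' CE]] := (alternating_mxP Balt, alternating_mxP Calt).
(* The upper left block of phi(z) adds the transposed lower right block of z, so the latter is taken
   zero. *)
have [z zE] := mx_of_onto (block_mx A B' C' 0).
apply/memv_imgP; exists z; rewrite ?memvf //; apply: mx_of_inj.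
by rewrite (mx_of_symm zE) xE trmx0 addr0 -BE -CE.
Qed.

Lemma Lf2_mx x : x \in Lf2 f <-> exists A B C : 'M[F]_n,
  [/\ mx_of e x = block_mx A B C A^T, alternating_mx B, alternating_mx C
    & \tr A = 0].
Proof.
rewrite Lf2E; split=> [/andP[/Lf1_mx[A [B [C [xE Balt Calt]]]] /eqP tr0] |].
  by exists A, B, C; split; rewrite // -(half_tr_mx xE).
case=> A [B [C [xE Balt Calt tr0]]]; rewrite (half_tr_mx xE) tr0 eqxx andbT.
by apply/Lf1_mx; exists A, B, C.
Qed.

(* For x in L(f) the map v |-> f(xv, v) is additive but only Frobenius-semilinear;
   diag_vec x records its values on the basis, i.e. the diagonals of B and C. *)
Definition diag_vec x : V := \sum_(i < n + n) f (x e`_i) e`_i *: sdual i.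

Lemma diag_vec_linear : linear diag_vec.
Proof.
move=> k x y; rewrite /diag_vec scaler_sumr -big_split; apply: eq_bigr => i _ /=.
by rewrite add_lfunE scale_lfunE formDl formZl scalerDl scalerA.
Qed.
HB.instance Definition _ := GRing.isSemilinear.Build F 'End(V) V _
  diag_vec (GRing.semilinear_linear diag_vec_linear).

Lemma form_diag_vec x (j : 'I_(n + n)) : f (diag_vec x) e`_j = f (x e`_j) e`_j.
Proof.
rewrite /diag_vec linear_sumlz (bigD1 j) //= big1 => [|i ij];
  rewrite formZl (formC (sdual _)) form_sdual.
  by rewrite eqxx mulr1 addr0.
by rewrite eq_sym (negPf ij) mulr0.
Qed.

(** In characteristic 2 a symmetric block with zero diagonal is alternating. *)
Lemma Lf1E x : x \in Lf f -> (x \in Lf1 f) = (diag_vec x == 0).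
Proof.
move=> xL; apply/idP/eqP => [x1|x0].
  by rewrite /diag_vec big1 // => i _; rewrite Lf1_alternating // scale0r.
have xe0 (j : 'I_(n + n)) : f (x e`_j) e`_j = 0 by rewrite -form_diag_vec x0 form0l.
have /Lf_mx[A [B [C [xE BE CE]]]] := xL.
apply/Lf1_mx; exists A, B, C; split=> //; split=> [i j|i].
- by rewrite oppr_pchar2 // -[in LHS]BE mxE.
- by rewrite -(block_mxEur A B C A^T) -xE mx_of_form sdual_l -sbasis_r.
- by rewrite oppr_pchar2 // -[in LHS]CE mxE.
- by rewrite -(block_mxEdl A B C A^T) -xE mx_of_form sdual_r -sbasis_l.
Qed.

Lemma diag_vec_rank1 i : diag_vec (rank1 (sdual i) (sdual i)) = sdual i.
Proof.
rewrite /diag_vec (bigD1 i) //= big1 ?addr0 => [|j ji]; rewrite rank1E form_sdual.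
  by rewrite eqxx scale1r formC form_sdual eqxx scale1r.
by rewrite (negPf ji) scale0r form0l scale0r.
Qed.

Lemma diag_vec_onto : (linfun diag_vec @: Lf f = fullv)%VS.
Proof.
apply/eqP; rewrite eqEsubv subvf; apply/subvP => v _.
rewrite (sdual_sum v) rpred_sum // => i _; rewrite rpredZ //.
by rewrite -(diag_vec_rank1 i) -lfunE memv_img // rank1_Lf.
Qed.

Lemma dim_Lf_Lf1 : \dim (Lf f) = (\dim (Lf1 f) + (n + n))%N.
Proof.
rewrite -(limg_ker_dim (linfun diag_vec)) diag_vec_onto dimV.
congr (\dim _ + _)%N; apply/vspaceP => x; rewrite memv_cap memv_ker lfunE /=.
case: (boolP (x \in Lf f)) => [/Lf1E -> //|xL].
by apply/esym/negbTE; apply: contra xL; apply: (subvP Lf1_sub).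
Qed.

Lemma lker_symm : lker symm = Lf f.
Proof. by apply/vspaceP => x; rewrite memv_ker symm_eq0. Qed.

(** Rank-nullity for phi on gl(V) gives m^2 = dim L(f) + dim L(f)^(1) = 2 dim L(f)^(1) + m. *)
Lemma dim_Lf1 : \dim (Lf1 f) = 'C(n + n, 2).
Proof.
have := limg_ker_dim symm fullv; rewrite capfv lker_symm -Lf1_symm dim_Lf_Lf1.
rewrite !dimvf /dim /= -dimvf dimV => dimE.
rewrite bin2 -[LHS]doubleK; congr _./2; apply/eqP.
rewrite -(eqn_add2r (n + n)) -addnn addnAC dimE.
by case: (n + n)%N => //= k; rewrite -mulnSr.
Qed.

Lemma dim_slv : (0 < n)%N -> (\dim (slv V)).+1 = \dim {:'End(V)}.
Proof.
move=> n_gt0; rewrite -(limg_ker_dim (linfun (@gl_tr F V)) fullv) capfv -addn1.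
congr (_ + _)%N; apply/esym/eqP.
have -> : limg (linfun (@gl_tr F V)) = fullv.
  apply/eqP; rewrite eqEsubv subvf; apply/subvP => k _; apply/memv_imgP.
  pose i := Ordinal n_gt0; exists (k *: rank1 (p i) (q i)); rewrite ?memvf //.
  by rewrite linearZ /= lfunE /= gl_tr_rank1 fpq eqxx; apply/esym/mulr1.
by rewrite dimvf.
Qed.

(** phi has the same kernel L(f) on sl(V) as on gl(V), so the codimension one is inherited by the
    images. *)
Lemma dim_Lf2 : (0 < n)%N -> (\dim (Lf2 f)).+1 = \dim (Lf1 f).
Proof.
move=> n_gt0; have := limg_ker_dim symm (slv V).
rewrite lker_symm (capv_idPr Lf_sl) -Lf2_symm => dim2.
have := limg_ker_dim symm fullv; rewrite capfv lker_symm -Lf1_symm -(dim_slv n_gt0).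
by rewrite -dim2 -addnS => /addnI.
Qed.

Lemma form_basis_sum u v : f u v =
  \sum_i f u (q i) * f v (p i) + \sum_i f u (p i) * f v (q i).
Proof. by rewrite form_sum big_split. Qed.

(** The upper left block of [x,y] has trace tr(AA2 + A2A) + tr(BC2 + B2C), with A2, B2, C2 the
    blocks of y. The first term vanishes, and for symmetric blocks the second involves diagonals
    only. *)
Lemma half_tr_br x y : x \in Lf f -> y \in Lf f ->
  half_tr (gl_br x y) = f (diag_vec x) (diag_vec y).
Proof.
move=> xL yL.
pose s (a b : 'I_n -> 'I_n -> F) := \sum_i \sum_j a i j * b i j.
pose A z i j := f (z (p i)) (q j); pose A' z i j := f (z (q i)) (p j).
pose B z i j := f (z (q i)) (q j); pose C z i j := f (z (p i)) (p j).
have sAA' : s (A x) (A' y) = s (A y) (A' x).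
  rewrite /s exchange_big /=; apply: eq_bigr => j _; apply: eq_bigr => i _.
  by rewrite /A /A' mulrC (Lf_symmetric _ (p j) yL) (Lf_symmetric (p i) _ xL).
have sBC z t : z \in Lf f -> t \in Lf f ->
    s (C z) (B t) = \sum_i f (z (p i)) (p i) * f (t (q i)) (q i).
  move=> zL tL; apply: sum_symmetric => // i j.
  by rewrite /C /B (Lf_symmetric _ _ zL) (Lf_symmetric _ _ tL).
have cross (z t : 'End(V)) :
    \sum_i f (z (p i)) (t (q i)) = s (A z) (A' t) + s (C z) (B t).
  rewrite /s -big_split; apply: eq_bigr => i _ /=.
  by rewrite form_basis_sum.
transitivity (\sum_i f (y (p i)) (x (q i)) + \sum_i f (x (p i)) (y (q i))).
  rewrite -big_split; apply: eq_bigr => i _ /=.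
  by rewrite gl_br_app formDl (Lf_form (y _) _ xL) (Lf_form (x _) _ yL).
rewrite !cross sAA' addrACA addrr_pchar2 // add0r !sBC //.
rewrite form_basis_sum; congr (_ + _); apply: eq_bigr => i _.
  by rewrite -!sbasis_l -!sbasis_r !form_diag_vec mulrC.
by rewrite -!sbasis_l -!sbasis_r !form_diag_vec.
Qed.

(** * The Heisenberg quotient *)

Lemma Lf_br_closed : br_closed gl_br (Lf f).
Proof. by move=> x y xL yL; apply: (subvP Lf1_sub); apply: Lf1_br. Qed.

Lemma Lf2_br_closed : br_closed gl_br (Lf2 f).
Proof. by move=> x y x2 y2; rewrite Lf2_br ?(subvP Lf2_sub) ?(subvP Lf2_sub_Lf1). Qed.

(** Combines the invariant cutting L(f)^(1) out of L(f) with the one cutting L(f)^(2) out of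
    L(f)^(1). *)
Definition heis_map : 'Hom('End(V), (V * F^o)%type) :=
  linfun (fun x => (diag_vec x, half_tr x)).

Lemma heis_mapE x : heis_map x = (diag_vec x, half_tr x).
Proof. by rewrite linear_lfunE // => k y z; rewrite !linearP. Qed.

Lemma heis_map_eq0 x : x \in Lf f -> (heis_map x == 0) = (x \in Lf2 f).
Proof. by move=> xL; rewrite heis_mapE Lf2E Lf1E // -pair_eqE. Qed.

Lemma dim_heis : \dim {: (V * F^o)%type} = (n + n).+1.
Proof. by rewrite dimvf /dim /= -dimvf dimV addn1. Qed.

Lemma heis_presents : (0 < n)%N ->
  presents_br gl_br (Lf f) (Lf2 f) (heis_br f) heis_map.
Proof.
move=> n_gt0; split=> [|x xL|x y xL yL]; last 2 first.
- exact: heis_map_eq0.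
- rewrite !heis_mapE /heis_br /= half_tr_br //; congr (_, _).
  by apply/eqP; rewrite -Lf1E ?Lf_br_closed ?Lf1_br.
(* Surjectivity by counting: the kernel L(f)^(2) has codimension 2n + 1 in L(f). *)
apply/eqP; rewrite eqEdim subvf dim_heis.
have := limg_ker_dim heis_map (Lf f).
have -> : (Lf f :&: lker heis_map)%VS = Lf2 f.
  apply/vspaceP => x; rewrite memv_cap (memv_ker heis_map).
  case: (boolP (x \in Lf f)) => [|xL]; first exact: heis_map_eq0.
  by apply/esym/negbTE; apply: contra xL; apply: (subvP Lf2_sub).
rewrite dim_Lf_Lf1 -(dim_Lf2 n_gt0) addSnnS => /addnI ->.
by rewrite leqnn.
Qed.

Lemma Lf_heis_iso : (0 < n)%N ->
  lie_iso (factor_br gl_br (Lf2 f) (Lf f)) (heis_br f).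
Proof.
move=> n_gt0; apply: presents_br_iso Lf_br_closed _ (heis_presents n_gt0).
apply: factor_presents_br (gl_lie V) Lf_br_closed _ => x y xL /(subvP Lf2_sub_Lf1).
exact: Lf2_br.
Qed.

Lemma Lf_gl_lin (a : subvs_of (Lf f)) : linear (Lf_gl f a).
Proof. by have [[linr _] _ _] := gl_lie V; apply: linr. Qed.

Lemma submoduleP (X : {vspace 'End(V)}) : submodule (Lf_gl f) X <->
  (forall x, x \in Lf f -> {in X, forall y, gl_br x y \in X}).
Proof.
split=> [sX x xL y yX | sX a y yX]; last by rewrite sX ?subvsP.
by have := sX (vsproj _ x) y yX; rewrite /Lf_gl vsprojK.
Qed.

(** * Symmetric and exterior squares *)

Definition tens_endo : 'Hom('Hom('Hom(V, F^o), V), 'End(V)) :=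
  linfun (fun t => (t \o flat)%VF).

Lemma tens_endoE t : tens_endo t = (t \o flat)%VF.
Proof.
by rewrite linear_lfunE // => k t1 t2; rewrite comp_lfunDl comp_lfunZl.
Qed.

Lemma tens_endo_tens v w : tens_endo (tens v w) = rank1 v w.
Proof.
by apply/lfunP => u; rewrite tens_endoE comp_lfunE tensE flatE rank1E formC.
Qed.

Lemma tens_endo_eq0 t : (tens_endo t == 0) = (t == 0).
Proof.
apply/eqP/eqP => [t0|->]; last exact: linear0.
apply/lfunP => phi; rewrite -[phi]flatVK -comp_lfunE -tens_endoE t0.
by rewrite !zero_lfunE.
Qed.

(** On the dual, x acts by precomposition; for self-adjoint x, [flat] turns this into x itself. *)
Lemma tens_endo_act (a : subvs_of (Lf f)) t :
  tens_endo (Lf_tens f a t) = Lf_gl f a (tens_endo t).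
Proof.
have aL := subvsP a; rewrite /Lf_tens /Lf_gl; apply/lfunP => u.
rewrite gl_br_app !tens_endoE !comp_lfunE /tens_act add_lfunE !comp_lfunE.
have lin : linear (fun phi : 'Hom(V, F^o) => (phi \o vsval a)%VF).
  by move=> k r s; rewrite comp_lfunDl comp_lfunZl.
suff -> : linfun (fun phi : 'Hom(V, F^o) => (phi \o vsval a)%VF) (flat u)
  = flat (vsval a u) by [].
rewrite (linear_lfunE lin); apply/lfunP => w.
by rewrite comp_lfunE !flatE (Lf_form _ _ aL).
Qed.

Lemma tens_endo_wedge v w : tens_endo (wedge v w) = symT v w.
Proof. by rewrite linearB /= !tens_endo_tens subv_char2 // symT_def. Qed.

Lemma tens_endo_ext2 : (tens_endo @: ext2 V = Lf1 f)%VS.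
Proof.
have /ext2_sub wedge_mem := subvv (ext2 V).
apply/eqP; rewrite eqEsubv; apply/andP; split.
  apply/subvP => _ /memv_imgP[t t2 ->]; rewrite memv_preim; apply: subvP t2.
  by apply/ext2_sub => v w; rewrite -memv_preim tens_endo_wedge symT_Lf1.
rewrite Lf1_symm; apply/subvP => _ /memv_imgP[z _ ->].
have [s ->] := rank1_sum z; rewrite linear_sum rpred_sum // => -[v w] _ /=.
by rewrite -[symm _]/(symT v w) -tens_endo_wedge memv_img.
Qed.

Lemma ext2_sub_sym2 : (ext2 V <= sym2 V)%VS.
Proof.
have /sym2_sub[_ sym_mem] := subvv (sym2 V).
by apply/ext2_sub => v w; rewrite /wedge subv_char2.
Qed.

Lemma tens_endo_sym2 : (tens_endo @: sym2 V = Lf f)%VS.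
Proof.
have /sym2_sub[sq_mem _] := subvv (sym2 V).
apply/eqP; rewrite eqEsubv; apply/andP; split.
  apply/subvP => _ /memv_imgP[t t2 ->]; rewrite memv_preim; apply: subvP t2.
  apply/sym2_sub; split=> [v | v w]; rewrite -memv_preim.
    by rewrite tens_endo_tens rank1_Lf.
  by rewrite linearD /= !tens_endo_tens -symT_def symT_Lf.
apply/subvP => x xL.
have sq_img v : rank1 v v \in (tens_endo @: sym2 V)%VS.
  by rewrite -tens_endo_tens memv_img.
have /memv_imgP[y yL] : diag_vec x \in (linfun diag_vec @: Lf f)%VS.
  by rewrite diag_vec_onto memvf.
(* A combination of squares with the same diagonal as x; the difference lies in L(f)^(1), already
   the image of the exterior square. *)
pose y' : 'End(V) := \sum_(i < n + n) f (x e`_i) e`_i *: rank1 (sdual i) (sdual i).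
have y'L : y' \in Lf f by rewrite rpred_sum // => i _; rewrite rpredZ ?rank1_Lf.
have dy' : diag_vec y' = diag_vec x.
  rewrite [in RHS]/diag_vec linear_sum; apply: eq_bigr => i _.
  by rewrite linearZ /= diag_vec_rank1.
rewrite -(subrK y' x) rpredD //; last first.
  by rewrite rpred_sum // => i _; rewrite rpredZ.
apply: (subvP (limgS _ ext2_sub_sym2)); rewrite tens_endo_ext2.
by rewrite Lf1E ?rpredB // linearB /= dy' subrr.
Qed.

Lemma tens_endo_presents (U : {vspace 'Hom('Hom(V, F^o), V)}) :
    submodule (Lf_gl f) (tens_endo @: U) ->
  presents (Lf_tens f) U 0%VS (sub_act (Lf_gl f) (tens_endo @: U))
    (linfun (vsproj (tens_endo @: U)) \o tens_endo)%VF.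
Proof.
move=> sU; apply: presents_comp (sub_presents sU) _ _ _ => // [t _|a t _].
  by rewrite !memv0 tens_endo_eq0.
exact: tens_endo_act.
Qed.

Lemma tens_endo_iso U X : submodule (Lf_tens f) U -> submodule (Lf_gl f) X ->
  (tens_endo @: U = X)%VS -> mod_iso (sub_act (Lf_gl f) X) (sub_act (Lf_tens f) U).
Proof.
move=> sU sX UX; move: (sX); rewrite -UX => sX'.
exact: presents_iso sU (tens_endo_presents sX') (sub_presents sU).
Qed.

Lemma Lf_sym2_iso :
  mod_iso (sub_act (Lf_gl f) (Lf f)) (sub_act (Lf_tens f) (sym2 V)).
Proof.
apply: tens_endo_iso (@Lf_submodule _ _ f) tens_endo_sym2 => a.
exact: sym2_submodule.
Qed.

Lemma Lf1_ext2_iso :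
  mod_iso (sub_act (Lf_gl f) (Lf1 f)) (sub_act (Lf_tens f) (ext2 V)).
Proof.
apply: tens_endo_iso (@Lf1_submodule _ _ f) tens_endo_ext2 => a.
exact: ext2_submodule.
Qed.

(** The contraction is the half-trace read on tensors: on v ^ w it gives the trace of [rank1 v w],
    which is f(v,w). It is invariant because [L(f), L(f)^(1)] lies in L(f)^(2). *)
Lemma contraction_exists : (0 < n)%N ->
  exists c : 'Hom(subvs_of (ext2 V), F^o),
     [/\ forall v w, c (vsproj (ext2 V) (wedge v w)) = f v w,
         limg c = {: F^o}%VS,
         forall (y : subvs_of (Lf f)) (u : subvs_of (ext2 V)),
           c (sub_act (Lf_tens f) (ext2 V) y u)
                     = trivial_act y (c u)
       & mod_iso (sub_act (Lf_gl f) (Lf2 f))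
           (sub_act (sub_act (Lf_tens f) (ext2 V)) (lker c))].
Proof.
move=> n_gt0; have /ext2_sub wedge_mem := subvv (ext2 V).
have s2 : submodule (Lf_tens f) (ext2 V) by move=> a; apply: ext2_submodule.
pose i := linfun (vsval : subvs_of (ext2 V) -> _).
pose c : 'Hom(subvs_of (ext2 V), F^o) := (linfun half_tr \o tens_endo \o i)%VF.
have cE (t : subvs_of (ext2 V)) : c t = half_tr (tens_endo (vsval t)).
  by rewrite comp_lfunE comp_lfunE (lfunE half_tr) (lfunE vsval).
have c_wedge v w : c (vsproj (ext2 V) (wedge v w)) = f v w.
  by rewrite cE vsprojK // tens_endo_wedge half_tr_symm gl_tr_rank1.
have c_triv g t : c (sub_act (Lf_tens f) (ext2 V) g t) = 0.
  rewrite cE sub_actE // tens_endo_act; apply/eqP.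
  have : tens_endo (vsval t) \in Lf1 f by rewrite -tens_endo_ext2 memv_img ?subvsP.
  by move/(Lf2_br (subvsP g)); rewrite Lf2E => /andP[].
exists c; split=> //.
  apply/eqP; rewrite eqEsubv subvf; apply/subvP => k _; apply/memv_imgP.
  pose j := Ordinal n_gt0; exists (vsproj (ext2 V) (wedge ((k : F) *: p j) (q j))).
    exact: memvf.
  by rewrite c_wedge formZl fpq eqxx; apply/esym/mulr1.
(* The kernel is moved from the type of the exterior square to the tensor space, so that one U
   presents both modules. *)
pose U := (i @: lker c)%VS.
have U_ext t : t \in U -> t \in ext2 V.
  by case/memv_imgP => y _ ->; rewrite lfunE subvsP.
have mem_U t : t \in ext2 V -> (t \in U) = (half_tr (tens_endo t) == 0).
  move=> t2; apply/memv_imgP/idP => [[y yc ->]|ht].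
    by rewrite lfunE /= -cE -memv_ker.
  by exists (vsproj _ t); rewrite ?memv_ker ?cE ?lfunE /= vsprojK.
have sU : submodule (Lf_tens f) U.
  move=> a u uU; have u2 := U_ext u uU; rewrite mem_U ?s2 //.
  by have := c_triv a (vsproj _ u); rewrite cE sub_actE // vsprojK // => ->.
have sK : submodule (sub_act (Lf_tens f) (ext2 V)) (lker c).
  by move=> a u _; rewrite memv_ker c_triv.
have UE : (tens_endo @: U = Lf2 f)%VS.
  apply/vspaceP => x; rewrite Lf2E -tens_endo_ext2; apply/memv_imgP/andP.
    by case=> u uU ->; rewrite memv_img ?U_ext // -mem_U ?U_ext.
  by case=> /memv_imgP[u u2 ->] hu; exists u; rewrite ?mem_U.
have pres1 := presents_comp (sub_presents (@Lf2_submodule _ _ f)) UE.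
have pres2 : presents (Lf_tens f) U 0%VS _ _ :=
  presents_comp (sub_presents sK) (_ : linfun (vsproj (ext2 V)) @: U = lker c)%VS _ _.
apply: presents_iso sU (pres1 _ _ _ _) (pres2 _ _ _).
- by move=> t _; rewrite !memv0 tens_endo_eq0.
- by move=> a t _; apply: tens_endo_act.
- rewrite -limg_comp; apply/vspaceP => u; apply/memv_imgP/idP => [[t tc ->]|uc].
    by rewrite comp_lfunE !lfunE /= vsvalK.
  by exists u; rewrite // comp_lfunE !lfunE /= vsvalK.
- move=> u /U_ext u2; rewrite lfunE /= !memv0 -(inj_eq (@subvs_inj _ _ _)).
  by rewrite /= vsprojK.
- by move=> a u /U_ext u2; rewrite !lfunE /= /sub_act vsprojK.
Qed.

(** * The series of gl(V) *)

(** This is why the inserted subspaces may be arbitrary. *)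
Lemma between_submodule (X : {vspace 'End(V)}) :
  (Lf1 f <= X)%VS -> (X <= Lf f)%VS -> submodule (Lf_gl f) X.
Proof.
move=> s1X sXL; apply/submoduleP => x xL y yX.
by apply: (subvP s1X); apply: Lf1_br; rewrite // (subvP sXL).
Qed.

Lemma gl_br_scalar x y : y \in scalv V -> gl_br x y = 0.
Proof.
case/vlineP => k ->; rewrite gl_brE -comp_lfunZl -comp_lfunZr.
by rewrite comp_lfun1l comp_lfun1r addvv_char2.
Qed.

Lemma scalv_submodule : submodule (Lf_gl f) (scalv V).
Proof. by apply/submoduleP => x _ y ys; rewrite gl_br_scalar ?mem0v. Qed.

Lemma slv_submodule : submodule (Lf_gl f) (slv V).
Proof. by apply/submoduleP => x _ y _; rewrite gl_br_sl. Qed.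

Lemma fullv_submodule : submodule (Lf_gl f) fullv.
Proof. by move=> *; apply: memvf. Qed.

(** The condition on scalars serves W = 0 and W = s alike: a submodule above W inside L(f)^(2)
    equals W or contains a nonscalar element. *)
Lemma Lf2_covers (W : {vspace 'End(V)}) : (1 < n)%N ->
    (W <= Lf2 f)%VS -> (Lf2 f :&: scalv V <= W)%VS -> W != Lf2 f ->
  covers (Lf_gl f) W (Lf2 f).
Proof.
move=> n_gt1 sW2 s2W neqW2; split=> // X /submoduleP sX sWX sX2.
have [sXs|/subvPn[y yX y_nonscal]] := boolP (X <= scalv V)%VS.
  by left; apply/eqP; rewrite eqEsubv sWX andbT (subv_trans _ s2W) // subv_cap sX2.
right; apply/eqP; rewrite eqEsubv sX2 Lf2_symm symm_sl_isotropic //.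
apply: isotropic_submodule sX _ yX y_nonscal; last exact: subv_trans Lf2_sub_Lf1.
by rewrite dimV (leq_add n_gt1 n_gt1).
Qed.

Lemma Lf2_ideals (W X : {vspace 'End(V)}) : (2 < n)%N ->
    (Lf2 f :&: scalv V <= W)%VS -> (W <= X)%VS -> (X <= Lf2 f)%VS ->
    {in Lf2 f & X, forall x y, gl_br x y \in X} ->
  X = W \/ X = Lf2 f.
Proof.
move=> n_gt2 s2W sWX sX2 idX.
have [sXs|/subvPn[y yX y_nonscal]] := boolP (X <= scalv V)%VS.
  by left; apply/eqP; rewrite eqEsubv sWX andbT (subv_trans _ s2W) // subv_cap sX2.
right; apply/eqP; rewrite eqEsubv sX2 Lf2_symm symm_sl_isotropic //.
apply: isotropic_ideal _ _ yX y_nonscal; last exact: subv_trans Lf2_sub_Lf1.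
  by rewrite dimV (leq_add n_gt2 n_gt2).
by move=> x x2 z zX; apply: idX.
Qed.

Lemma natr_char2 (k : nat) : k%:R = (odd k)%:R :> F.
Proof.
by rewrite -[in LHS](odd_double_half k) natrD -addnn natrD addrr_pchar2 // addr0.
Qed.

Lemma half_tr_id : half_tr \1%VF = (odd n)%:R.
Proof.
rewrite -natr_char2 /half_tr -[in RHS](card_ord n) -sum1_card natr_sum.
by apply: eq_bigr => i _; rewrite id_lfunE fpq eqxx.
Qed.

Lemma id_neq0 : (0 < n)%N -> \1%VF != 0 :> 'End(V).
Proof.
move=> n_gt0; pose i := Ordinal n_gt0; apply/eqP => id0.
have := fpq i i; rewrite -[p i]id_lfunE id0 zero_lfunE form0l eqxx => /eqP.
by rewrite eq_sym oner_eq0.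
Qed.

Lemma dim_slv_Lf : \dim (slv V) = (\dim (Lf f) + \dim (Lf2 f))%N.
Proof. by rewrite -(limg_ker_dim symm) lker_symm (capv_idPr Lf_sl) -Lf2_symm. Qed.

(** Keeps the factor nontrivial even after division by the scalars. *)
Lemma dim_Lf2_gt2 : (1 < n)%N -> (2 < \dim (Lf2 f))%N.
Proof.
move=> n_gt1; rewrite -ltnS dim_Lf2 ?(ltnW n_gt1) // dim_Lf1.
exact: leq_trans (leq_bin2l 2 (leq_add n_gt1 n_gt1)).
Qed.

Lemma Lf_chain_factors t WU : (0 < n)%N ->
    strict_chain (Lf1 f) (Lf f) t (n + n - 1) ->
    WU \in factors (Lf1 f :: rcons t (Lf f)) ->
  [/\ (WU.1 <= WU.2)%VS, \dim WU.2 = (\dim WU.1).+1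
    & forall (g : subvs_of (Lf f)) x, x \in WU.2 -> Lf_gl f g x \in WU.1].
Proof.
move=> n_gt0 chain; case/(strict_chain_factors chain).
  by rewrite dim_Lf_Lf1 subn1 prednK // addn_gt0 n_gt0.
move=> s1W sWU sUL dimU; split=> // a u uU; apply: (subvP s1W).
by apply: Lf1_br; [apply: subvsP | apply: (subvP sUL)].
Qed.

Lemma Lf_chain_exists : (0 < n)%N ->
  exists t, strict_chain (Lf1 f) (Lf f) t (n + n - 1).
Proof.
move=> n_gt0; apply: strict_chain_exists Lf1_sub _.
by rewrite dim_Lf_Lf1 subn1 prednK // addn_gt0 n_gt0.
Qed.

Lemma Lf2_scalar_odd : odd n -> (Lf2 f :&: scalv V = 0)%VS.
Proof.
move=> n_odd; apply/eqP; rewrite -subv0; apply/subvP => x.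
case/memv_capP => x2 /vlineP[k xE]; move: x2; rewrite Lf2E xE linearZ /= half_tr_id.
by rewrite n_odd => /andP[_]; rewrite [_ *: _]mulr1 => /eqP ->; rewrite scale0r mem0v.
Qed.

Lemma gl_series_odd : n <> 1%N -> odd n ->
    has_composition_factors (Lf_gl f) (n + n + 4) /\
    (exists t, strict_chain (Lf1 f) (Lf f) t (n + n - 1)) /\
    (forall t, strict_chain (Lf1 f) (Lf f) t (n + n - 1) ->
      let s := [:: 0%VS; Lf2 f; Lf1 f] ++ t ++
               [:: Lf f; slv V; {:'End(V)}%VS] in
      composition_series (Lf_gl f) s /\
      forall WU, WU \in factors s ->
        (trivial_factor (factor_act (Lf_gl f) WU.1 WU.2) <->
         WU != (0%VS, Lf2 f) /\ WU != (Lf f, slv V))) /\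
    mod_iso (sub_act (Lf_gl f) (Lf2 f))
            (factor_act (Lf_gl f) (Lf f) (slv V)) /\
    lie_simple (sub_br gl_br (Lf2 f)) /\
    \dim (Lf2 f) = ('C(n + n, 2) - 1)%N.
Proof.
move=> n_neq1 n_odd; have n_gt2 : (2 < n)%N by case: (n) n_neq1 n_odd => [|[|[]]].
have n_gt1 : (1 < n)%N := ltnW n_gt2; have n_gt0 : (0 < n)%N := ltnW n_gt1.
have dim2_gt2 := dim_Lf2_gt2 n_gt1.
have cov2 : covers (Lf_gl f) 0%VS (Lf2 f).
  apply: Lf2_covers; rewrite ?sub0v // ?Lf2_scalar_odd ?subvv //.
  by rewrite eq_sym -dimv_eq0 -lt0n (ltn_trans _ dim2_gt2).
(* sl(V) / L(f) is presented by L(f)^(2) itself through phi, so its irreducibility is transferred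
   and not reproved. *)
have pres_sl : presents (Lf_gl f) (slv V) (Lf f) (sub_act (Lf_gl f) (Lf2 f))
    (linfun (vsproj (Lf2 f)) \o symm)%VF.
  apply: presents_comp (sub_presents (@Lf2_submodule _ _ f)) (esym Lf2_symm) _ _.
    by move=> u _; rewrite memv0 symm_eq0.
  by move=> a u _; rewrite /Lf_gl gl_br_symm ?subvsP.
have irr2 : irreducible_mod (sub_act (Lf_gl f) (Lf2 f)).
  exact/(presents_irr (sub0v _) (@Lf2_submodule _ _ f)
    (sub_presents (@Lf2_submodule _ _ f))).
have cov_sl : covers (Lf_gl f) (Lf f) (slv V).
  exact/(presents_irr Lf_sl slv_submodule pres_sl).
pose big := [:: (0%VS, Lf2 f); (Lf f, slv V)].
have series t : strict_chain (Lf1 f) (Lf f) t (n + n - 1) ->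
    let s := [:: 0%VS; Lf2 f; Lf1 f] ++ t ++ [:: Lf f; slv V; {:'End(V)}%VS] in
    composition_series (Lf_gl f) s /\
    {in factors s, forall WU,
      trivial_factor (factor_act (Lf_gl f) WU.1 WU.2) <-> WU \notin big}.
  move=> chain s; apply: composition_series_mixed Lf_gl_lin _ _ _ _ _ => //.
  - by rewrite /s !last_cat.
  - move=> X; rewrite !mem_cat !inE -!orbA.
    case/or4P=> [/eqP->|/eqP->|/eqP->|].
    + exact: submodule0 Lf_gl_lin.
    + exact: Lf2_submodule.
    + exact: Lf1_submodule.
    case/or4P=> [Xt|/eqP->|/eqP->|/eqP->].
    + have [s1X sXL] := strict_chain_mem chain Xt; exact: between_submodule.
    + exact: Lf_submodule.
    + exact: slv_submodule.
    + exact: fullv_submodule.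
  - move=> WU; rewrite /big !inE => /orP[] /eqP -> /=; split=> //.
      by rewrite dimv0 (ltn_trans _ dim2_gt2).
    by rewrite dim_slv_Lf -addn1 ltn_add2l (ltn_trans _ dim2_gt2).
  (* Regrouped so that [factors_cat] splits the series at L(f)^(1) and at L(f). *)
  have -> : s = 0%VS :: [:: Lf2 f; Lf1 f] ++ (rcons t (Lf f) ++ [:: slv V; fullv]).
    by rewrite cat_rcons.
  move=> WU; rewrite factors_cat [last _ _]/= factors_cat last_rcons !mem_cat.
  case/or3P; last 1 first.
  - rewrite !inE => /orP[] /eqP ->; first by left; rewrite eqxx orbT.
    right; split=> /= [||a u _]; rewrite ?subvf ?dim_slv // /Lf_gl.
    exact: gl_br_sl.
  - rewrite !inE => /orP[] /eqP ->; first by left; rewrite eqxx.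
    right; split=> /= [||a u u1]; rewrite ?Lf2_sub_Lf1 ?dim_Lf2 //.
    by apply: Lf2_br; rewrite ?subvsP.
  - by move/(Lf_chain_factors n_gt0 chain); right.
have [t chain] := Lf_chain_exists n_gt0.
split; last split; last split; last split; last split.
- have [cs _] := series t chain; have := composition_series_unique Lf_gl_lin cs.
  (* The m - 1 inserted and six fixed terms make m + 4 consecutive pairs. *)
  rewrite size_factors /= size_cat /=; case/andP: chain => /eqP -> _.
  have nn_gt0 : (0 < n + n)%N by rewrite addn_gt0 n_gt0.
  by rewrite -[in X in _ -> X](prednK nn_gt0) subn1 addSnnS !addnS !addn0.
- by exists t.
- move=> {chain}t chain s; have [cs triv] := series t chain; split=> // WU WUs.
  by apply: (iff_trans (triv _ WUs)); rewrite !inE negb_or; split=> /andP.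
- apply: presents_iso slv_submodule pres_sl _.
  exact: factor_presents Lf_gl_lin (@Lf_submodule _ _ f) slv_submodule.
- have pres := sub_presents_br Lf2_br_closed.
  apply/(presents_br_simple (gl_lie V) (sub0v _) Lf2_br_closed pres); split.
    by rewrite dimv0 subn0 ltnW.
  by move=> X sWX sX2; apply: Lf2_ideals; rewrite // Lf2_scalar_odd // subvv.
- by rewrite -dim_Lf1 -dim_Lf2 // subn1.
Qed.

(** * Even n: scalars inside L(f)^(2), and the element x *)

Section EvenCase.
Variable x0 : 'End(V).
Hypothesis x0E : mx_of e x0 = block_mx 1%:M 0 0 0.
Hypothesis n_even : ~~ odd n.
Hypothesis n_gt0 : (0 < n)%N.
Local Notation U := (Lf f + <[x0]>)%VS.

Let n_gt1 : (1 < n)%N. Proof. by case: (n) n_even n_gt0 => [|[]]. Qed.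

(** The purpose of x: phi(x) = 1, so U is the preimage of the scalars under phi. *)
Lemma symm_x0 : symm x0 = \1%VF.
Proof.
apply: mx_of_inj; rewrite (mx_of_symm x0E) mx_of_id !trmx0 !addr0 trmx1.
by rewrite -scalar_mx_block.
Qed.

Lemma x0_sl : x0 \in slv V.
Proof.
rewrite mem_slv (gl_trE x0 sbasis_basis) x0E mxtrace_block mxtrace1 mxtrace0 addr0.
by rewrite natr_char2 (negPf n_even).
Qed.

Lemma scalv_sub_Lf2 : (scalv V <= Lf2 f)%VS.
Proof. by rewrite -memvE Lf2_symm -symm_x0 memv_img ?x0_sl. Qed.

Lemma Lf_x0_directv : directv (Lf f + <[x0]>).
Proof.
apply/directv_addP/eqP; rewrite -subv0; apply/subvP => y /memv_capP[yL /vlineP[k yE]].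
move: yL; rewrite yE -symm_eq0 linearZ /= symm_x0 scaler_eq0 (negPf (id_neq0 n_gt0)).
by rewrite orbF => /eqP ->; rewrite scale0r mem0v.
Qed.

(** phi([y,x]) = [y,1] = 0. *)
Lemma x0_normalizes y : y \in Lf f -> gl_br x0 y \in Lf f.
Proof.
move=> yL; rewrite gl_brC -symm_eq0 gl_br_symm // symm_x0.
by rewrite gl_br_scalar ?memv_line.
Qed.

Lemma symm_scalar y : (symm y \in scalv V) = (y \in U).
Proof.
apply/vlineP/memv_addP => [[k yE] | [z zL [_ /vlineP[k ->] ->]]].
  exists (y - k *: x0); last first.
    by exists (k *: x0); rewrite ?rpredZ ?memv_line ?subrK.
  by rewrite -symm_eq0 linearB linearZ /= symm_x0 yE subrr.
exists k; rewrite linearD linearZ /= symm_x0.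
by move: zL; rewrite -symm_eq0 => /eqP ->; rewrite add0r.
Qed.

Lemma U_submodule : submodule (Lf_gl f) U.
Proof.
apply/submoduleP => x xL y /memv_addP[z zL [_ /vlineP[k ->] ->]].
rewrite -(addr0 (gl_br x _)) memv_add ?mem0v // gl_brDr.
apply: rpredD; first exact: Lf_br_closed.
by rewrite gl_brZr rpredZ // gl_brC x0_normalizes.
Qed.

Lemma U_sub_sl : (U <= slv V)%VS.
Proof. by rewrite subv_add Lf_sl -memvE x0_sl. Qed.

Lemma dim_U : \dim U = (\dim (Lf f)).+1.
Proof.
rewrite (directvP Lf_x0_directv) /= dim_vline.
suff -> : x0 != 0 by rewrite addn1.
apply: contraNneq (id_neq0 n_gt0) => x00.
by rewrite -symm_x0 x00 linear0.
Qed.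

Let scal2 : {in Lf2 f & scalv V, forall x y, gl_br x y \in scalv V}.
Proof. by move=> x y _ ys; rewrite gl_br_scalar ?mem0v. Qed.

Let dim_scalv : \dim (scalv V) = 1%N.
Proof. by rewrite dim_vline id_neq0. Qed.

(** Here n = 2. The coefficient of T(p0,p1) in the bracket is the half-trace of y, hence 0; what
    remains is a multiple of T(p0,q0) + T(p1,q1) = 1. This is the obstruction to simplicity for m =
    4. *)
Lemma isotropic_plane_br (i0 i1 : 'I_n) y : i0 != i1 ->
    (forall i, i = i0 \/ i = i1) -> y \in Lf2 f ->
  gl_br y (symT (p i0) (p i1)) = f (y (p i0)) (p i1) *: \1%VF.
Proof.
move=> ne01 all01 y2; have yL := subvP Lf2_sub _ y2.
have y1 := subvP Lf2_sub_Lf1 _ y2.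
have sum2 (W : nmodType) (g : 'I_n -> W) : \sum_i g i = g i0 + g i1.
  rewrite (bigD1 i0) //= (bigD1 i1) 1?eq_sym //= big1 ?addr0 // => i.
  by case: (all01 i) => ->; rewrite eqxx ?andbF.
have tr0 : f (y (p i0)) (q i0) + f (y (p i1)) (q i1) = 0.
  by move: y2; rewrite Lf2E => /andP[_ /eqP]; rewrite /half_tr sum2.
rewrite gl_br_symT //; set d := f (y (p i0)) (p i1).
have d10 : f (y (p i1)) (p i0) = d by rewrite Lf_symmetric.
rewrite (symplectic_sum (y (p i0))) (symplectic_sum (y (p i1))) !sum2.
rewrite -/d d10 !Lf1_alternating // !scale0r !addr0.
rewrite !symTDl !symTDr !symTZl !symTZr !symTvv !scaler0 ?addr0 ?add0r.
rewrite [d *: symT (p i0) _ + _]addrC addrACA -scalerDl tr0 scale0r add0r -scalerDr.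
congr (_ *: _); apply/lfunP => u; rewrite id_lfunE [RHS](symplectic_sum u) sum2.
by rewrite add_lfunE !symTE addrC [f u (p i0) *: _ + _]addrC.
Qed.

Lemma gl_series_even :
    let U := (Lf f + <[x0]>)%VS in
    mx_of e x0 = block_mx 1%:M 0 0 0 /\
    directv (Lf f + <[x0]>) /\
    x0 \in slv V /\
    (forall y, y \in Lf f -> gl_br x0 y \in Lf f) /\
    has_composition_factors (Lf_gl f) (n + n + 6) /\
    (exists t, strict_chain (Lf1 f) (Lf f) t (n + n - 1)) /\
    (forall t, strict_chain (Lf1 f) (Lf f) t (n + n - 1) ->
      let s := [:: 0%VS; scalv V; Lf2 f; Lf1 f] ++ t ++
               [:: Lf f; U; slv V; {:'End(V)}%VS] in
      composition_series (Lf_gl f) s /\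
      forall WU, WU \in factors s ->
        (trivial_factor (factor_act (Lf_gl f) WU.1 WU.2) <->
         WU != (scalv V, Lf2 f) /\ WU != (U, slv V))) /\
    mod_iso (factor_act (Lf_gl f) (scalv V) (Lf2 f))
            (factor_act (Lf_gl f) U (slv V)) /\
    \dim {: subquov (scalv V) (Lf2 f)} = ('C(n + n, 2) - 2)%N /\
    lie_algebra (factor_br gl_br (scalv V) (Lf2 f)) /\
    (lie_simple (factor_br gl_br (scalv V) (Lf2 f)) <-> (4 < n + n)%N).
Proof.
have dim2_gt2 := dim_Lf2_gt2 n_gt1.
have neqs2 : scalv V != Lf2 f.
  by apply/eqP => eqs2; move: dim2_gt2; rewrite -eqs2 dim_scalv.
have cov2 : covers (Lf_gl f) (scalv V) (Lf2 f).
  by apply: Lf2_covers; rewrite ?scalv_sub_Lf2 ?capvSr.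
have pres2 := factor_presents Lf_gl_lin scalv_submodule (@Lf2_submodule _ _ f).
have pres_sl : presents (Lf_gl f) (slv V) U (factor_act (Lf_gl f) (scalv V) (Lf2 f))
    (fproj (scalv V) (Lf2 f) \o symm)%VF.
  apply: presents_comp pres2 (esym Lf2_symm) _ _; first by move=> y _; apply: symm_scalar.
  by move=> g y _; rewrite /Lf_gl gl_br_symm ?subvsP.
have irr2 : irreducible_mod (factor_act (Lf_gl f) (scalv V) (Lf2 f)).
  exact/(presents_irr scalv_sub_Lf2 (@Lf2_submodule _ _ f) pres2).
have cov_sl : covers (Lf_gl f) U (slv V).
  exact/(presents_irr U_sub_sl slv_submodule pres_sl).
pose big := [:: (scalv V, Lf2 f); (U, slv V)].
have series t : strict_chain (Lf1 f) (Lf f) t (n + n - 1) ->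
    let s := [:: 0%VS; scalv V; Lf2 f; Lf1 f] ++ t ++
             [:: Lf f; U; slv V; {:'End(V)}%VS] in
    composition_series (Lf_gl f) s /\
    {in factors s, forall WU,
      trivial_factor (factor_act (Lf_gl f) WU.1 WU.2) <-> WU \notin big}.
  move=> chain s; apply: composition_series_mixed Lf_gl_lin _ _ _ _ _ => //.
  - by rewrite /s !last_cat.
  - move=> X; rewrite !mem_cat !inE -!orbA.
    case/or4P=> [/eqP->|/eqP->|/eqP->|].
    + exact: submodule0 Lf_gl_lin.
    + exact: scalv_submodule.
    + exact: Lf2_submodule.
    case/or4P=> [/eqP->|Xt|/eqP->|].
    + exact: Lf1_submodule.
    + have [s1X sXL] := strict_chain_mem chain Xt; exact: between_submodule.
    + exact: Lf_submodule.
    case/or3P=> /eqP->.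
    + exact: U_submodule.
    + exact: slv_submodule.
    + exact: fullv_submodule.
  - move=> WU; rewrite /big !inE => /orP[] /eqP -> /=; split=> //.
      by rewrite dim_scalv.
    by rewrite dim_U dim_slv_Lf -addn2 ltn_add2l.
  have -> : s = 0%VS :: [:: scalv V; Lf2 f; Lf1 f] ++
      (rcons t (Lf f) ++ [:: U; slv V; fullv]) by rewrite cat_rcons.
  move=> WU; rewrite factors_cat [last _ _]/= factors_cat last_rcons !mem_cat.
  case/or3P; last 1 first.
  - rewrite !inE => /or3P[] /eqP ->; last 1 first.
    + right; split=> /= [||g y _]; rewrite ?subvf ?dim_slv //.
      exact: gl_br_sl.
    + right; split=> /= [||g y]; rewrite ?addvSl ?dim_U //.
      case/memv_addP=> z zL [_ /vlineP[k ->] ->]; have gL := subvsP g.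
      rewrite /Lf_gl gl_brDr; apply: rpredD; first exact: Lf_br_closed.
      by rewrite gl_brZr rpredZ // gl_brC x0_normalizes.
    + by left; rewrite eqxx orbT.
  - rewrite !inE => /or3P[] /eqP ->; last 1 first.
    + right; split=> /= [||g y y1]; rewrite ?Lf2_sub_Lf1 ?dim_Lf2 //.
      by apply: Lf2_br; rewrite ?subvsP.
    + right; split=> /= [||g y ys]; rewrite ?sub0v ?dim_scalv ?dimv0 //.
      by rewrite /Lf_gl gl_br_scalar ?mem0v.
    + by left; rewrite eqxx.
  - by move/(Lf_chain_factors n_gt0 chain); right.
have [t chain] := Lf_chain_exists n_gt0.
have pres_br := factor_presents_br (gl_lie V) Lf2_br_closed scal2.
split=> //; split; first exact: Lf_x0_directv.
split; first exact: x0_sl.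
split; first exact: x0_normalizes.
split.
  have [cs _] := series t chain; have := composition_series_unique Lf_gl_lin cs.
  (* The m - 1 inserted and eight fixed terms make m + 6 consecutive pairs. *)
  rewrite size_factors /= size_cat /=; case/andP: chain => /eqP -> _.
  have nn_gt0 : (0 < n + n)%N by rewrite addn_gt0 n_gt0.
  by rewrite -[in X in _ -> X](prednK nn_gt0) subn1 addSnnS !addnS !addn0.
split; first by exists t.
split.
  move=> {chain}t chain s; have [cs triv] := series t chain; split=> // WU WUs.
  by apply: (iff_trans (triv _ WUs)); rewrite !inE negb_or; split=> /andP.
split.
  apply: presents_iso slv_submodule pres_sl _.
  exact: factor_presents Lf_gl_lin U_submodule slv_submodule.
have dim2 : (\dim (Lf2 f) - 1 = 'C(n + n, 2) - 2)%N.
  by rewrite -dim_Lf1 -dim_Lf2.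
split.
  by rewrite -dim2 -(presents_dim scalv_sub_Lf2 pres2) dim_scalv addnK.
split; first exact: (presents_br_lie (gl_lie V) Lf2_br_closed pres_br).
have simpleP := presents_br_simple (gl_lie V) scalv_sub_Lf2 Lf2_br_closed pres_br.
split=> [/simpleP[_ simp] | nn_gt4].
  rewrite ltnNge; apply/negP => nn_le4.
  have n2 : n = 2%N.
    apply/eqP; rewrite eqn_leq n_gt1 andbT leqNgt; apply/negP => n_gt2.
    by have := leq_trans (leq_add n_gt2 n_gt2) nn_le4.
  pose i0 := Ordinal n_gt0; pose i1 := Ordinal n_gt1.
  have all01 i : i = i0 \/ i = i1.
    case: i => [[|[|i]] lti]; [left | right | ]; try exact: val_inj.
    by exfalso; move: lti; rewrite [X in (_ < X)%N]n2.
  pose T := symT (p i0) (p i1).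
  have T2 : T \in Lf2 f by apply: isotropic_Lf2.
  have Tscal : T \notin scalv V.
    (* T sends q0 to p1, which is not a multiple of q0. *)
    apply/vlineP => -[k TE]; have /lfunP/(_ (q i0)) := TE.
    rewrite symTE scale_lfunE id_lfunE !fqp eqxx scale0r addr0 scale1r => p1E.
    have := fpq i1 i1; rewrite p1E formZl fqq mulr0 eqxx => /eqP.
    by rewrite eq_sym oner_eq0.
  (* An ideal of dimension at most 2, too small to be L(f)^(2). *)
  pose X := (scalv V + <[T]>)%VS.
  have [|||XE|XE] := simp X.
  - exact: addvSl.
  - by rewrite subv_add scalv_sub_Lf2 -memvE.
  - move=> y z y2 /memv_addP[w ws [_ /vlineP[k ->] ->]].
    rewrite gl_brDr gl_brZr gl_br_scalar // add0r (isotropic_plane_br _ all01) //.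
    by rewrite (subvP (addvSl _ _)) // !rpredZ ?memv_line.
  - by case/negP: Tscal; rewrite -XE (subvP (addvSr _ _)) ?memv_line.
  move: dim2_gt2; rewrite -XE ltnNge => /negP; apply.
  apply: leq_trans (dimv_add_leqif _ _) _.
  by rewrite dim_scalv dim_vline leq_add2l leq_b1.
apply/simpleP; split; first by rewrite dim_scalv ltn_subRL.
move=> X sWX sX2; apply: Lf2_ideals sWX sX2; last exact: capvSr.
by rewrite ltnNge; apply: contraL nn_gt4 => n_le2; rewrite -leqNgt (leq_add n_le2 n_le2).
Qed.

End EvenCase.

End SymplecticBasis.

End Symplectic.

Theorem theorem1p1 (F : fieldType) (charF2 : 2%N \in [pchar F])
    (V : vectType F) (m n : nat) (m_eq : m = (2 * n)%N) (m_ge2 : (2 <= m)%N)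
    (dimV : \dim {:V} = m)
    (f : {biscalar V}) (f_alt : alternating_form f)
    (f_nondeg : nondegenerate_form f) :
  exists e : (n + n).-tuple V,
  basis_of {:V} e /\
  (* (1) *)
  ((4 %| m)%N ->
    exists x : 'End(V), let U := (Lf f + <[x]>)%VS in
    mx_of e x = block_mx 1%:M 0 0 0 /\
    directv (Lf f + <[x]>) /\
    x \in slv V /\
    (forall y, y \in Lf f -> gl_br x y \in Lf f) /\
    has_composition_factors (Lf_gl f) (m + 6) /\
    (exists t, strict_chain (Lf1 f) (Lf f) t (m - 1)) /\
    (forall t, strict_chain (Lf1 f) (Lf f) t (m - 1) ->
      let s := [:: 0%VS; scalv V; Lf2 f; Lf1 f] ++ t ++
               [:: Lf f; U; slv V; {:'End(V)}%VS] in
      composition_series (Lf_gl f) s /\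
      forall WU, WU \in factors s ->
        (trivial_factor (factor_act (Lf_gl f) WU.1 WU.2) <->
         WU != (scalv V, Lf2 f) /\ WU != (U, slv V))) /\
    mod_iso (factor_act (Lf_gl f) (scalv V) (Lf2 f))
            (factor_act (Lf_gl f) U (slv V)) /\
    \dim {: subquov (scalv V) (Lf2 f)} = ('C(m, 2) - 2)%N /\
    lie_algebra (factor_br gl_br (scalv V) (Lf2 f)) /\
    (lie_simple (factor_br gl_br (scalv V) (Lf2 f)) <-> (4 < m)%N)) /\
  (* (2) *)
  (m <> 2%N -> ~~ (4 %| m)%N ->
    has_composition_factors (Lf_gl f) (m + 4) /\
    (exists t, strict_chain (Lf1 f) (Lf f) t (m - 1)) /\
    (forall t, strict_chain (Lf1 f) (Lf f) t (m - 1) ->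
      let s := [:: 0%VS; Lf2 f; Lf1 f] ++ t ++
               [:: Lf f; slv V; {:'End(V)}%VS] in
      composition_series (Lf_gl f) s /\
      forall WU, WU \in factors s ->
        (trivial_factor (factor_act (Lf_gl f) WU.1 WU.2) <->
         WU != (0%VS, Lf2 f) /\ WU != (Lf f, slv V))) /\
    mod_iso (sub_act (Lf_gl f) (Lf2 f))
            (factor_act (Lf_gl f) (Lf f) (slv V)) /\
    lie_simple (sub_br gl_br (Lf2 f)) /\
    \dim (Lf2 f) = ('C(m, 2) - 1)%N) /\
  (* (3) *)
  (mod_iso (sub_act (Lf_gl f) (Lf f))
           (sub_act (Lf_tens f) (sym2 V)) /\
   forall x, x \in Lf f <->
     exists A B C : 'M[F]_n,
       [/\ mx_of e x = block_mx A B C A^T, B^T = B & C^T = C]) /\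
  (* (4) *)
  (mod_iso (sub_act (Lf_gl f) (Lf1 f))
           (sub_act (Lf_tens f) (ext2 V)) /\
   forall x, x \in Lf1 f <->
     exists A B C : 'M[F]_n,
       [/\ mx_of e x = block_mx A B C A^T, alternating_mx B
         & alternating_mx C]) /\
  (* (5) *)
  ((exists c : 'Hom(subvs_of (ext2 V), F^o),
     [/\ forall v w, c (vsproj (ext2 V) (wedge v w)) = f v w,
         limg c = {: F^o}%VS,
         forall y u, c (sub_act (Lf_tens f) (ext2 V) y u)
                     = trivial_act y (c u)
       & mod_iso (sub_act (Lf_gl f) (Lf2 f))
           (sub_act (sub_act (Lf_tens f) (ext2 V)) (lker c))]) /\
   forall x, x \in Lf2 f <->
     exists A B C : 'M[F]_n,
       [/\ mx_of e x = block_mx A B C A^T, alternating_mx B,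
           alternating_mx C & \tr A = 0]) /\
  (* (6) *)
  (lie_iso (factor_br gl_br (Lf2 f) (Lf f)) (heis_br f) /\
   \dim {: (V * F^o)%type} = (2 * n).+1).
Proof.
have nn : m = (n + n)%N by rewrite m_eq mul2n addnn.
have n_gt0 : (0 < n)%N by move: m_ge2; rewrite m_eq; case: (n).
(* Dimensions are put in the form n + n, the size of the block matrices. *)
rewrite -!m_eq; move: dimV {m_eq m_ge2}; rewrite nn {m nn} => dimV.
have [|p' [q' pq]] := symplectic_family charF2 f_alt f_nondeg (k := n).
  by rewrite dimV mul2n addnn.
pose p (i : 'I_n) := p' i; pose q (i : 'I_n) := q' i.
have fpp i j : f (p i) (p j) = 0 by have [] := pq i j (ltn_ord i) (ltn_ord j).
have fqq i j : f (q i) (q j) = 0 by have [] := pq i j (ltn_ord i) (ltn_ord j).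
have fpq i j : f (p i) (q j) = (i == j)%:R.
  by have [] := pq i j (ltn_ord i) (ltn_ord j).
exists (sbasis p q).
have four_dvd : (4 %| n + n)%N = ~~ odd n.
  by rewrite addnn -muln2 (@dvdn_pmul2r 2 2) // dvdn2.
split; first exact: (sbasis_basis charF2 f_alt dimV fpp fqq fpq).
split.
  rewrite four_dvd => n_even.
  have [x xE] := mx_of_onto charF2 f_alt dimV fpp fqq fpq (block_mx 1%:M 0 0 0).
  by exists x; apply: (gl_series_even charF2 f_alt f_nondeg dimV fpp fqq fpq xE).
split.
  rewrite four_dvd negbK => nn2 n_odd.
  apply: (gl_series_odd charF2 f_alt f_nondeg dimV fpp fqq fpq _ n_odd) => n1.
  by apply: nn2; rewrite n1.
split; [split | split; [split | split; [split | split]]].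
- exact: (Lf_sym2_iso charF2 f_alt f_nondeg dimV fpp fqq fpq).
- exact: (Lf_mx charF2 f_alt f_nondeg dimV fpp fqq fpq).
- exact: (Lf1_ext2_iso charF2 f_alt f_nondeg).
- exact: (Lf1_mx charF2 f_alt f_nondeg dimV fpp fqq fpq).
- exact: (contraction_exists charF2 f_alt f_nondeg dimV fpp fqq fpq).
- exact: (Lf2_mx charF2 f_alt f_nondeg dimV fpp fqq fpq).
- exact: (Lf_heis_iso charF2 f_alt f_nondeg dimV fpp fqq fpq).
exact: dim_heis dimV.
Qed.
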